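(* Let $M$ be a smooth $n$-dimensional manifold, $E=\mathbb R\times TM$ and let $\Gamma$ be a second-order differential equation field on $E$, with associated tensors $S,Q$ and projectors $P_\Gamma,P_H,P_V$. Define submodule covariant derivatives on $\operatorname{im}(P_\Gamma)$, $\operatorname{im}(P_H)$, $\operatorname{im}(P_V)$ respectively by $$\nabla^\Gamma_XY:=X(dt(Y))\Gamma,\quad \nabla^H_XY:=Q([X,S(Y)]),\quad \nabla^V_XY:=S([X,Q(Y)]),$$ and let $\bar\nabla^\Gamma,\bar\nabla^H,\bar\nabla^V$ be their extensions. Then the Massa–Pagani connection $\hat\nabla$ of $\Gamma$ is given, for $X,Y\in\mathfrak X(E)$, by $$\hat\nabla_XY=\bar\nabla^\Gamma_X(P_\Gamma(Y))+\bar\nabla^H_X(P_H(Y))+\bar\nabla^V_X(P_V(Y)).$$ Explicitly, $$\begin{aligned}\hat\nabla_XY=\ &X(dt(Y))\Gamma+Q([P_H(X),S(Y)])+S([P_V(X),Q(Y)])\\&+P_H([X-P_H(X),P_H(Y)])+P_V([X-P_V(X),P_V(Y)]).\end{aligned}$$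
   Context: $E=\mathbb R\times TM$ has adapted local coordinates $(t,x^i,u^i)$, $i=1,\dots,n$, where $(x^i)$ are local coordinates on $M$; summation over repeated indices is understood. A second-order differential equation field is a vector field on $E$ of the form $$\Gamma=\frac{\partial}{\partial t}+u^i\frac{\partial}{\partial x^i}+F^i\frac{\partial}{\partial u^i},$$ with $F^i(t,x,u)$ smooth (it represents the system $\ddot x^i=F^i(t,x^j,\dot x^j)$). Put $$\Gamma^i_j:=-\tfrac12\frac{\partial F^i}{\partial u^j},\quad V_i:=\frac{\partial}{\partial u^i},\quad H_i:=\frac{\partial}{\partial x^i}-\Gamma^j_i\frac{\partial}{\partial u^j}.$$ Then $\{\Gamma,V_i,H_i\}$ is a local frame on $E$, with dual coframe $\{dt,\psi^i,\theta^i\}$, where $\theta^i=dx^i-u^idt$ and $\psi^i=du^i-F^idt+\Gamma^i_j\theta^j$. The following $(1,1)$ tensors on $E$ are globally defined: $$S=\theta^i\otimes V_i,\quad Q=\psi^i\otimes H_i,\quad P_\Gamma=dt\otimes\Gamma,\quad P_V=\psi^i\otimes V_i,\quad P_H=\theta^i\otimes H_i,$$ where $(\alpha\otimes Z)(X)=\alpha(X)Z$. The three projectors give a direct sum decomposition of $\mathfrak X(E)$. Extension: for a projector $P$ and a submodule covariant derivative $\nabla^P$ on $\operatorname{im}(P)$ (a map defined on pairs from $\operatorname{im}(P)$ with the usual covariant derivative properties), $\bar\nabla^P_XY:=\nabla^P_{P(X)}Y+P([X-P(X),Y])$ for $X\in\mathfrak X(E)$, $Y\in\operatorname{im}(P)$.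 The Massa–Pagani connection of $\Gamma$ is the linear connection $\hat\nabla$ on $E$ whose components in the frames $\{\Gamma,V_i,H_i\}$ are $$\hat\nabla_\Gamma H_i=\Gamma^j_iH_j,\quad \hat\nabla_\Gamma V_i=\Gamma^j_iV_j,\quad \hat\nabla_{H_i}H_j=\frac{\partial\Gamma^k_i}{\partial u^j}H_k,\quad \hat\nabla_{H_i}V_j=\frac{\partial\Gamma^k_i}{\partial u^j}V_k,$$ with all other covariant derivatives of frame fields along frame fields equal to zero. *)

(* Defs.v *)
From mathcomp Require Import all_boot all_order all_algebra.
From mathcomp Require Import all_classical all_reals all_analysis.

Set Implicit Arguments.
Unset Strict Implicit.
Unset Printing Implicit Defensive.

Import Order.TTheory GRing.Theory Num.Theory.
Import numFieldNormedType.Exports.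

Local Open Scope classical_set_scope.
Local Open Scope ring_scope.

(* C^k and C^oo maps on an open subset [U] of a finite-dimensional space. *)
Fixpoint Ck (R : realType) (V W : normedModType R) (k : nat) (U : set V)
    (f : V -> W) : Prop :=
  if k is k'.+1 then
    (forall z, U z -> differentiable f z) /\ (forall v, Ck k' U ('D_v f))
  else forall z, U z -> {for z, continuous f}.

Definition Cinf (R : realType) (V W : normedModType R) (U : set V)
    (f : V -> W) : Prop := forall k, Ck k U f.

Section Charts.
Variables (R : realType) (T : Type) (V : normedModType R).

(* A family of charts on [T]: only the values of [coord a] on [dom a] are
   meaningful. *)
Record charting := Charting {
  idx : Type;
  dom : idx -> set T;
  coord : idx -> T -> V }.

Variable A : charting.

(* The local representative g o (coord a)^-1 on coord a @` dom a, and 0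
   elsewhere. *)
Definition local_rep (Z : normedModType R) (a : idx A) (g : T -> Z) (z : V) : Z :=
  xget 0 [set y | exists e, [/\ dom a e, coord a e = z & y = g e]].

Definition transition (a b : idx A) : V -> V := local_rep a (coord b).

(* The topology induced by the charts. *)
Definition chart_open (W : set T) : Prop :=
  forall a : idx A, open (coord a @` (W `&` dom a)).

(* A tangent vector at [p] is given by its components in all the charts around
   [p]; these are related by the Jacobians of the coordinate changes. *)
Definition tangent_components (p : T) (v : idx A -> V) : Prop :=
  forall a b, dom a p -> dom b p ->
    v b = 'd (transition a b) (coord a p) (v a).

(* The tangent bundle; [comp_out] fixes the irrelevant values, so that elements
   with the same base point and the same components are equal. *)
Record tangent := Tangent {
  foot : T;
  comp : idx A -> V;
  comp_out : forall a, ~ dom a foot -> comp a = 0;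
  comp_compat : tangent_components foot comp }.

(* Vector fields are handled through their components [X a e] at the point [e]
   in the chart [a], where [e] is in [dom a].  Similarly, [g a e] is the local
   expression in the chart [a] of a (scalar or vector valued) quantity [g]. *)
Definition vfield := idx A -> T -> V.

Definition smooth_on (Z : normedModType R) (W : set T) (g : idx A -> T -> Z) :=
  forall a, Cinf (coord a @` (W `&` dom a)) (local_rep a (g a)).

Definition smooth_fun_on (W : set T) (f : T -> R) : Prop :=
  smooth_on (Z := R^o) W (fun=> f).

(* [X] is a smooth vector field on the open set [W]; the values of [X] outside
   [W] are irrelevant. *)
Definition vector_field (W : set T) (X : vfield) : Prop :=
  (forall e, W e -> tangent_components e (X^~ e)) /\ smooth_on W X.

Definition vf_eq (W : set T) (X Y : vfield) : Prop :=
  forall a e, W e -> dom a e -> X a e = Y a e.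

Definition vf_add (X Y : vfield) : vfield := fun a e => X a e + Y a e.
Definition vf_sub (X Y : vfield) : vfield := fun a e => X a e - Y a e.
Definition vf_scale (f : idx A -> T -> R) (X : vfield) : vfield :=
  fun a e => f a e *: X a e.

(* The derivative along X of the local expression of [g] in each chart. *)
Definition along (Z : normedModType R) (X : vfield) (g : idx A -> T -> Z) :
    idx A -> T -> Z :=
  fun a e => 'd (local_rep a (g a)) (coord a e) (X a e).

Definition deriv_fun (X : vfield) (g : idx A -> T -> R) : idx A -> T -> R :=
  along (Z := R^o) X g.

Definition bracket (X Y : vfield) : vfield :=
  fun a e => along X Y a e - along Y X a e.

Definition im_on (P : vfield -> vfield) (W : set T) (X : vfield) : Prop :=
  vector_field W X /\ vf_eq W (P X) X.

(* Covariant derivatives on the submodule im P of the vector fields.  As usual,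
   they are regarded as acting on the sections over any open set [W], with
   values that only depend on these sections. *)
Record submodule_covariant_derivative (P : vfield -> vfield)
    (nabla : vfield -> vfield -> vfield) : Prop := {
  scd_im : forall W X Y, chart_open W -> im_on P W X -> im_on P W Y ->
    im_on P W (nabla X Y);
  scd_local : forall W X X' Y Y', chart_open W ->
    im_on P W X -> im_on P W X' -> im_on P W Y -> im_on P W Y' ->
    vf_eq W X X' -> vf_eq W Y Y' -> vf_eq W (nabla X Y) (nabla X' Y');
  scd_addl : forall W X X' Y, chart_open W ->
    im_on P W X -> im_on P W X' -> im_on P W Y ->
    vf_eq W (nabla (vf_add X X') Y) (vf_add (nabla X Y) (nabla X' Y));
  scd_scalel : forall W f X Y, chart_open W -> smooth_fun_on W f ->
    im_on P W X -> im_on P W Y ->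
    vf_eq W (nabla (vf_scale (fun=> f) X) Y) (vf_scale (fun=> f) (nabla X Y));
  scd_addr : forall W X Y Y', chart_open W ->
    im_on P W X -> im_on P W Y -> im_on P W Y' ->
    vf_eq W (nabla X (vf_add Y Y')) (vf_add (nabla X Y) (nabla X Y'));
  scd_leibniz : forall W f X Y, chart_open W -> smooth_fun_on W f ->
    im_on P W X -> im_on P W Y ->
    vf_eq W (nabla X (vf_scale (fun=> f) Y))
      (vf_add (vf_scale (deriv_fun X (fun=> f)) Y)
              (vf_scale (fun=> f) (nabla X Y))) }.

Definition linear_connection (nabla : vfield -> vfield -> vfield) : Prop :=
  submodule_covariant_derivative id nabla.

Definition extension (P : vfield -> vfield) (nabla : vfield -> vfield -> vfield) :
    vfield -> vfield -> vfield :=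
  fun X Y => vf_add (nabla (P X) Y) (P (bracket (vf_sub X (P X)) Y)).

End Charts.

Record smooth_manifold (R : realType) (n : nat) := SmoothManifold {
  mpoint :> topologicalType;
  mcharts : charting mpoint 'rV[R]_n;
  mfd_hausdorff : hausdorff_space mpoint;
  mfd_second_countable : @second_countable mpoint;
  mfd_cover : forall p, exists a : idx mcharts, dom a p;
  mfd_dom_open : forall a : idx mcharts, open (dom a);
  mfd_coord_inj : forall a : idx mcharts, set_inj (dom a) (coord a);
  mfd_coord_continuous : forall a : idx mcharts, {within dom a, continuous (coord a)};
  mfd_coord_open : forall (a : idx mcharts) (U : set mpoint), open U ->
        open (coord a @` (U `&` dom a));
  mfd_transition_smooth : forall a b : idx mcharts,
        Cinf (coord a @` (dom a `&` dom b)) (transition a b) }.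

Definition tangent_bundle (R : realType) (n : nat) (M : smooth_manifold R n) :=
  tangent (mcharts M).

(* The manifold E = R x TM with its adapted coordinates (t, x, u). *)
Definition evolution_space (R : realType) (n : nat) (M : smooth_manifold R n) :
    Type := (R * tangent_bundle M)%type.

Definition ecoord (R : realType) (n : nat) : normedModType R :=
  (R * 'rV[R]_n * 'rV[R]_n)%type.

Definition adapted (R : realType) (n : nat) (M : smooth_manifold R n) :
    charting (evolution_space M) (ecoord R n) :=
  Charting
    (fun (a : idx (mcharts M)) => [set e : evolution_space M | dom a (foot e.2)])
    (fun a e => ((e.1, coord a (foot e.2)), comp e.2 a)).

Section SecondOrder.
Variables (R : realType) (n : nat) (M : smooth_manifold R n).

Local Notation E := (evolution_space M).
Local Notation C := (idx (adapted M)).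
Local Notation field := (vfield (adapted M)).
Implicit Types (G X Y : field) (a : C) (e : E) (i j k : 'I_n).

Definition unit_vec i : 'rV[R]_n := delta_mx 0 i.

(* A vector field with components (1, u^i, F^i) in every adapted chart. *)
Definition second_order_field G : Prop :=
  vector_field setT G /\
  forall a e, dom a e -> (G a e).1 = (1, (coord a e).2).

Definition force G a i e : R := (G a e).2 0 i.

(* The partial derivative d g / d u^j in the adapted chart [a]. *)
Definition partial_u a j (g : E -> R) e : R :=
  'D_((0, 0, unit_vec j) : ecoord R n) (local_rep (Z := R^o) a g) (coord a e).

(* Gamma^i_j *)
Definition conn_coef G a i j e : R := - 2^-1 * partial_u a j (force G a i) e.

(* Frame and coframe of the adapted chart [a] at points [e] of its domain,
   expressed by their components in this chart. *)
Definition frame_V a i e : ecoord R n := (0, 0, unit_vec i).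
Definition frame_H G a i e : ecoord R n :=
  (0, unit_vec i, - \sum_j conn_coef G a j i e *: unit_vec j).

Definition form_dt a e (v : ecoord R n) : R := v.1.1.
Definition form_theta a i e (v : ecoord R n) : R :=
  v.1.2 0 i - (coord a e).2 0 i * form_dt a e v.
Definition form_psi G a i e (v : ecoord R n) : R :=
  v.2 0 i - force G a i e * form_dt a e v
  + \sum_j conn_coef G a i j e * form_theta a j e v.

Definition dt_of Y : C -> E -> R := fun a e => form_dt a e (Y a e).

Definition tensor_S X : field :=
  fun a e => \sum_i form_theta a i e (X a e) *: frame_V a i e.
Definition tensor_Q G X : field :=
  fun a e => \sum_i form_psi G a i e (X a e) *: frame_H G a i e.
Definition proj_G G X : field := fun a e => form_dt a e (X a e) *: G a e.
Definition proj_V G X : field :=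
  fun a e => \sum_i form_psi G a i e (X a e) *: frame_V a i e.
Definition proj_H G X : field :=
  fun a e => \sum_i form_theta a i e (X a e) *: frame_H G a i e.

Inductive frame_index := IG | IV of 'I_n | IH of 'I_n.

Definition frame G a (p : frame_index) e : ecoord R n :=
  match p with
  | IG => G a e
  | IV i => frame_V a i e
  | IH i => frame_H G a i e
  end.

(* The covariant derivative of the frame field [q] along the frame field [p]
   for the Massa-Pagani connection. *)
Definition massa_pagani_frame G a (p q : frame_index) e : ecoord R n :=
  match p, q with
  | IG, IH i => \sum_j conn_coef G a j i e *: frame_H G a j e
  | IG, IV i => \sum_j conn_coef G a j i e *: frame_V a j e
  | IH i, IH j =>
      \sum_k partial_u a j (conn_coef G a k i) e *: frame_H G a k e
  | IH i, IV j =>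
      \sum_k partial_u a j (conn_coef G a k i) e *: frame_V a k e
  | _, _ => 0
  end.

Definition massa_pagani G (nabla : field -> field -> field) : Prop :=
  linear_connection nabla /\
  forall a p q (W : set E) X Y,
    chart_open (adapted M) W -> W `<=` dom a ->
    vector_field W X -> vector_field W Y ->
    (forall e, W e -> X a e = frame G a p e) ->
    (forall e, W e -> Y a e = frame G a q e) ->
    forall e, W e -> nabla X Y a e = massa_pagani_frame G a p q e.

Definition nabla_G G X Y : field := vf_scale (deriv_fun X (dt_of Y)) G.
Definition nabla_H G X Y : field := tensor_Q G (bracket X (tensor_S Y)).
Definition nabla_V G X Y : field := tensor_S (bracket X (tensor_Q G Y)).

End SecondOrder.

(* Main.v *)
Require Import Defs.
From HB Require Import structures.
From mathcomp Require Import all_boot all_order all_algebra ring.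
From mathcomp Require Import all_classical all_reals all_analysis.
(* [coord] of MathComp's vector.v would otherwise hide [Defs.coord]. *)
Import Defs.

(* The bracket of vector fields transforms correctly under a change of chart
   because second derivatives commute.  Since the Lie derivative of S along Gamma
   is P_V - P_H, and P_V + P_H = id - P_Gamma, the projectors do not depend on
   the chart; nor does Q, which inverts S : im(P_H) -> im(P_V) and kills the other
   two summands.  As QS = P_H and SQ = P_V, and as Q vanishes on im(P_H) and S on
   im(P_V), the maps nabla^H and nabla^V are covariant derivatives by the Leibniz
   rule for brackets.  Finally, on the domain of a chart a linear connection is
   determined by its values on the frame {Gamma, V_i, H_i}; expanding both the
   Massa-Pagani connection and the four brackets in the components of X and Y
   gives the same expression. *)

Set Implicit Arguments.
Unset Strict Implicit.
Unset Printing Implicit Defensive.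

Import Order.TTheory GRing.Theory Num.Theory.
Import numFieldNormedType.Exports.

Local Open Scope classical_set_scope.
Local Open Scope ring_scope.

(** * Smooth maps between normed spaces *)

Section Calculus.
Variable R : realType.
Implicit Types U V W : normedModType R.

(** A direct proof that the horizontal projector is global would use the transformation law of the
    $\Gamma^i_j$, with its second derivatives of the coordinate change. Reading $P_V - P_H$ off
    brackets moves these derivatives into the naturality of the bracket; of the Jacobian on $E$ only
    the first components and the values on vertical vectors are then needed.

    Two features of the definitions shape the rest. A chart expression has content only on the image
    of its chart and is 0 elsewhere, so functions are compared as germs and identities between
    fields are stated over open sets. Smoothness is iterated differentiability in fixed directions,
    whereas brackets differentiate in moving directions; finitely many continuous coordinate forms
    bridge this gap.

    Since the frame exists only over a chart domain, the connection is evaluated on sections over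
    that domain, after its locality has allowed [X] and [Y] to be replaced by combinations of frame
    fields. Pointwise computations avoid indices: the coframe becomes the row-vector-valued forms
    [theta] and [psi], and $\Gamma^i_j$ becomes the linear map [nonlin]. *)

Lemma near_eq_differentiable V W (f g : V -> W) z :
  (\near z, f z = g z) -> differentiable f z ->
  differentiable g z /\ 'd g z = 'd f z :> (V -> W).
Proof.
move=> fg df.
have E : g \o shift z = cst (g z) + 'd f z +o_ 0 id.
  apply/eqaddoP => _/posnumP[e].
  have /eqaddoP /(_ e%:num) /(_ [gt0 of e%:num]) := diff_locally df.
  have fg0 : \forall h \near 0, f (h + z) = g (h + z).
    move: fg; rewrite (near_shift 0) /= subr0; exact: filterS.
  apply: filter_app; near=> h => /=.
  rewrite -![(_ + _ : _ -> _) _]/(_ + _) -![(- _ : _ -> _) _]/(- _) /=.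
  have -> : f (h + z) = g (h + z) by near: h.
  by rewrite (nbhs_singleton fg).
have Ed : 'd g z = 'd f z :> (V -> W) by apply: diff_unique => //; exact: diff_continuous.
split=> //; apply/diff_locallyP; rewrite Ed; split=> //; exact: diff_continuous.
Unshelve. all: by end_near. Qed.

Lemma open_near V (A : set V) z : open A -> A z -> \forall y \near z, A y.
Proof. by move=> oA Az; apply: open_nbhs_nbhs. Qed.

Lemma Ck_subset V W k (A B : set V) (f : V -> W) : B `<=` A -> Ck k A f -> Ck k B f.
Proof.
elim: k f => [|k IH] f BA /=; first by move=> cf z /BA /cf.
by move=> [df Df]; split=> [z /BA /df //|v]; apply: IH.
Qed.

Lemma Ck_pred V W k (A : set V) (f : V -> W) : Ck k.+1 A f -> Ck k A f.
Proof.
elim: k f => [|k IH] f.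
  by move=> [df _] z Az; apply: differentiable_continuous; apply: df.
by move=> [df Df]; split=> // v; apply: IH.
Qed.

Lemma Ck_eq V W k (A : set V) (f g : V -> W) : open A ->
  (forall z, A z -> f z = g z) -> Ck k A f -> Ck k A g.
Proof.
move=> oA; elim: k f g => [|k IH] f g fg /=.
  move=> cf z Az; rewrite /prop_for /continuous_at -fg //.
  apply: cvg_trans (cf z Az); apply: near_eq_cvg.
  by apply: filterS (open_near oA Az) => y /fg.
move=> [df Df]; split=> [z Az|v].
  by apply: (near_eq_differentiable _ (df z Az)).1; apply: filterS (open_near oA Az) => y /fg.
apply: IH (Df v) => z Az; apply: near_eq_derive.
by apply: filterS (open_near oA Az) => y /fg.
Qed.

Lemma Ck_differentiable V W k (A : set V) (f : V -> W) z : Ck k.+1 A f -> A z ->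
  differentiable f z.
Proof. by move=> [df _] /df. Qed.

Lemma Ck_derive V W k (A : set V) (f : V -> W) v : Ck k.+1 A f -> Ck k A ('D_v f).
Proof. by move=> [_]; apply. Qed.

Lemma Ck_cst V W k (A : set V) (w : W) : Ck k A (fun=> w).
Proof.
elim: k w => [|k IH] w /=; first by move=> z _; exact: cvg_cst.
split=> [z _|v]; first exact: differentiable_cst.
have -> : 'D_v (fun=> w) = (fun=> 0) :> (V -> W).
  by apply/funext => z; exact: derive_cst.
exact: IH.
Qed.

Lemma Ck_linear_comp V W U k (A : set V) (f : V -> W) (L : {linear W -> U}) :
  open A -> continuous L -> Ck k A f -> Ck k A (fun z => L (f z)).
Proof.
move=> oA cL; elim: k f => [|k IH] f /=.
  by move=> cf z Az; apply: continuous_comp; [exact: cf|exact: cL].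
move=> [df Df]; split=> [z Az|v].
  apply: differentiable_comp; [exact: df|exact: linear_differentiable].
apply: Ck_eq (IH _ (Df v)) => // z Az.
rewrite !deriveE; [|apply: differentiable_comp; [exact: df|exact: linear_differentiable]|exact: df].
rewrite (diff_comp (df z Az)) /= ?diff_lin //.
exact: linear_differentiable.
Qed.

Lemma Ck_linear V W k (A : set V) (L : {linear V -> W}) :
  continuous L -> Ck k A L.
Proof.
move=> cL; case: k => [|k] /=; first by move=> z Az; exact: cL.
split=> [z Az|v]; first exact: linear_differentiable.
have -> : 'D_v L = (fun=> L v).
  by apply/funext => z; rewrite deriveE ?diff_lin //; exact: linear_differentiable.
exact: Ck_cst.
Qed.

Lemma Ck_id V k (A : set V) : Ck k A (fun z => z).
Proof. by apply: (@Ck_linear _ _ k A idfun) => x. Qed.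

Lemma CkD V W k (A : set V) (f g : V -> W) : open A ->
  Ck k A f -> Ck k A g -> Ck k A (fun z => f z + g z).
Proof.
move=> oA; elim: k f g => [|k IH] f g /=.
  by move=> cf cg z Az; apply: continuousD; [exact: cf|exact: cg].
move=> [df Df] [dg Dg]; split=> [z Az|v].
  by apply: differentiableD; [exact: df|exact: dg].
apply: Ck_eq (IH _ _ (Df v) (Dg v)) => // z Az.
by rewrite -deriveD //; apply: diff_derivable; [exact: df|exact: dg].
Qed.

Lemma Ck_sum V W k (A : set V) (I : Type) (r : seq I) (f : I -> V -> W) : open A ->
  (forall i, Ck k A (f i)) -> Ck k A (fun z => \sum_(i <- r) f i z).
Proof.
move=> oA cf; elim: r => [|i r IH].
  by apply: Ck_eq (@Ck_cst _ _ k A 0) => // z _; rewrite big_nil.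
by apply: Ck_eq (CkD oA (cf i) IH) => // z _; rewrite big_cons.
Qed.

Lemma CkN V W k (A : set V) (f : V -> W) : open A -> Ck k A f -> Ck k A (fun z => - f z).
Proof.
move=> oA; elim: k f => [|k IH] f /=.
  by move=> cf z Az; apply: continuousN; exact: cf.
move=> [df Df]; split=> [z Az|v]; first by apply: differentiableN; exact: df.
apply: Ck_eq (IH _ (Df v)) => // z Az.
by rewrite -deriveN //; apply: diff_derivable; exact: df.
Qed.

Lemma CkB V W k (A : set V) (f g : V -> W) : open A ->
  Ck k A f -> Ck k A g -> Ck k A (fun z => f z - g z).
Proof. by move=> oA cf cg; apply: CkD => //; exact: CkN. Qed.

(** Differentiability and the value in one direction travel together, so that sum, product and chain
    rules compose without separate differentiability side conditions. *)
Definition has_diff V W (f : V -> W) (z h : V) (d : W) :=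
  differentiable f z /\ 'd f z h = d.

Lemma has_diff_eq V W (f : V -> W) z h d d' : d = d' -> has_diff f z h d -> has_diff f z h d'.
Proof. by move=> ->. Qed.

Lemma has_diff_near V W (f g : V -> W) z h d :
  (\near z, f z = g z) -> has_diff f z h d -> has_diff g z h d.
Proof.
move=> fg [df <-]; have [dg E] := near_eq_differentiable fg df.
exact: conj dg (congr1 (fun k : V -> W => k h) E).
Qed.

Lemma has_diff_cst V W (w : W) z (h : V) : has_diff (fun=> w) z h 0.
Proof. by split; [exact: differentiable_cst|rewrite diff_cst]. Qed.

Lemma has_diff_diff V W (f : V -> W) z h : differentiable f z -> has_diff f z h ('d f z h).
Proof. by []. Qed.

Lemma has_diffD V W (f g : V -> W) z h d d' :
  has_diff f z h d -> has_diff g z h d' -> has_diff (fun z => f z + g z) z h (d + d').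
Proof.
by move=> [df <-] [dg <-]; split; [exact: differentiableD|rewrite diffD].
Qed.

Lemma has_diffN V W (f : V -> W) z h d :
  has_diff f z h d -> has_diff (fun z => - f z) z h (- d).
Proof. by move=> [df <-]; split; [exact: differentiableN|rewrite diffN]. Qed.

Lemma has_diffB V W (f g : V -> W) z h d d' :
  has_diff f z h d -> has_diff g z h d' -> has_diff (fun z => f z - g z) z h (d - d').
Proof. by move=> hf hg; apply: has_diffD => //; exact: has_diffN. Qed.

Lemma has_diff_pair V W U (f : V -> W) (g : V -> U) z h d d' :
  has_diff f z h d -> has_diff g z h d' ->
  has_diff (fun z => (f z, g z) : (W * U)%type) z h (d, d').
Proof.
by move=> [df <-] [dg <-]; split; [exact: differentiable_pair|rewrite diff_pair].
Qed.

Lemma has_diff_comp V W U (f : V -> W) (g : W -> U) z h d d' :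
  has_diff f z h d -> has_diff g (f z) d d' -> has_diff (fun z => g (f z)) z h d'.
Proof.
move=> [df <-] [dg <-]; split; first exact: differentiable_comp.
by rewrite (diff_comp df dg).
Qed.

Lemma has_diff_linear V W U (f : V -> W) (L : {linear W -> U}) z h d :
  continuous L -> has_diff f z h d -> has_diff (fun z => L (f z)) z h (L d).
Proof.
move=> cL hf; apply: (has_diff_comp hf).
by split; [exact: linear_differentiable|rewrite diff_lin].
Qed.

Lemma has_diff_id V (z h : V) : has_diff (fun z => z) z h h.
Proof. by split; [apply: ex_diff|rewrite (@diff_val _ _ _ _ _ _ _ (is_diff_id z))]. Qed.

Lemma has_diff_fst V W U (f : V -> W * U) z h d :
  has_diff f z h d -> has_diff (fun z => (f z).1) z h d.1.
Proof. by apply: (@has_diff_linear _ _ _ _ fst) => x; exact: cvg_fst. Qed.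

Lemma has_diff_snd V W U (f : V -> W * U) z h d :
  has_diff f z h d -> has_diff (fun z => (f z).2) z h d.2.
Proof. by apply: (@has_diff_linear _ _ _ _ snd) => x; exact: cvg_snd. Qed.

Lemma has_diffZ V W (k : V -> R^o) (f : V -> W) z h dk d :
  has_diff k z h dk -> has_diff f z h d ->
  has_diff (fun z => k z *: f z) z h (k z *: d + dk *: f z).
Proof.
move=> hk hf.
have bil : bilinear_for (GRing.Scale.Law.clone _ _ *:%R _) (GRing.Scale.Law.clone _ _ *:%R _)
    (fun (a : R^o) (w : W) => a *: w).
  by split=> [w|a] b x y /=; rewrite ?scalerDl ?scalerDr !scalerA // mulrC.
pose bilM := bilinear_isBilinear.Build R R^o W W _ _ _ bil.
pose B : {bilinear R^o -> W -> W} := HB.pack (fun (a : R^o) (w : W) => a *: w) bilM.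
apply: (has_diff_comp (g := fun q : R^o * W => B q.1 q.2) (has_diff_pair hk hf)).
have cB : continuous (fun q : R^o * W => B q.1 q.2) by exact: scale_continuous.
split; first exact: differentiable_bilin.
by rewrite (diff_bilin _ cB).
Qed.

Lemma CkZ V W k (A : set V) (g : V -> R^o) (f : V -> W) : open A ->
  Ck k A g -> Ck k A f -> Ck k A (fun z => g z *: f z).
Proof.
move=> oA; elim: k g f => [|k IH] g f.
  by move=> cf cg z Az; apply: continuousZ; [exact: cf|exact: cg].
(* The Leibniz formula also contains the undifferentiated factors, which are therefore needed in
   class $C^k$ for the induction hypothesis. *)
move=> cg cf; have cg' := Ck_pred cg; have cf' := Ck_pred cf.
move: cg cf => [dg Dg] [df Df].
have D z v : A z -> has_diff (fun z => g z *: f z) z v (g z *: 'D_v f z + 'D_v g z *: f z).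
  move=> Az; rewrite !deriveE; [|exact: dg|exact: df].
  by apply: has_diffZ; apply: has_diff_diff; [exact: dg|exact: df].
split=> [z Az|v]; first by case: (D z 0 Az).
have := CkD oA (IH _ _ cg' (Df v)) (IH _ _ (Dg v) cf').
by apply: Ck_eq => // z Az; case: (D z v Az) => dd <-; rewrite deriveE.
Qed.

(* A basis with continuous coordinate forms; it turns ['d f z h] into a sum of
   products, so that smoothness of compositions follows by induction on the order. *)
Definition has_coords W := exists (I : finType) (e : I -> W) (c : I -> {linear W -> R^o}),
  (forall i, continuous (c i)) /\ forall w, w = \sum_i c i w *: e i.

Lemma has_coordsR : has_coords R^o.
Proof.
exists 'I_1, (fun=> 1 : R^o), (fun=> idfun); split=> [i x|w]; first exact: cvg_id.
by rewrite big_ord1 /= [_%:A]mulr1.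
Qed.

Fact entry_linear n (i : 'I_n) : linear ((fun v : 'rV[R]_n => v 0 i) : 'rV[R]_n -> R^o).
Proof. by move=> a x y; rewrite !mxE. Qed.

Definition entry n (i : 'I_n) : {linear 'rV[R]_n -> R^o} :=
  HB.pack ((fun v : 'rV[R]_n => v 0 i) : 'rV[R]_n -> R^o)
    (GRing.isLinear.Build _ _ _ _ _ (entry_linear i)).

Lemma Ck_entry V n k (A : set V) (w : V -> 'rV[R]_n) i : open A -> Ck k A w ->
  Ck (W := R^o) k A (fun z => w z 0 i).
Proof. by move=> oA; apply: (Ck_linear_comp (L := entry i) oA); exact: coord_continuous. Qed.

Lemma has_diff_entry V n (w : V -> 'rV[R]_n) z h d i : has_diff w z h d ->
  has_diff (W := R^o) (fun z => w z 0 i) z h (d 0 i).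
Proof. by apply: (has_diff_linear (L := entry i)); exact: coord_continuous. Qed.

Lemma has_coords_rV n : has_coords 'rV[R]_n.
Proof.
exists 'I_n, (fun j => delta_mx 0 j), (@entry n); split=> [j|w]; last exact: row_sum_delta.
exact: coord_continuous.
Qed.

Lemma has_coords_prod V W : has_coords V -> has_coords W -> has_coords (V * W)%type.
Proof.
move=> [I [e [c [cc ce]]]] [J [e' [c' [cc' ce']]]].
exists (I + J)%type, (fun x => match x with inl i => (e i, 0) | inr j => (0, e' j) end),
  (fun x => match x return {linear (V * W)%type -> R^o} with
    inl i => c i \o fst | inr j => c' j \o snd end).
split=> [[i|j] z|[v w]].
- by apply: continuous_comp; [exact: cvg_fst|exact: cc].
- by apply: continuous_comp; [exact: cvg_snd|exact: cc'].
rewrite big_sumType /= [in LHS](ce v) [in LHS](ce' w).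
have E1 (r : seq I) f : \sum_(i <- r) f i *: (e i, 0 : W) = (\sum_(i <- r) f i *: e i, 0).
  elim: r => [|i r IH]; first by rewrite !big_nil.
  by rewrite !big_cons IH; congr (_, _) => /=; rewrite scaler0 addr0.
have E2 (r : seq J) f : \sum_(i <- r) f i *: (0 : V, e' i) = (0, \sum_(i <- r) f i *: e' i).
  elim: r => [|i r IH]; first by rewrite !big_nil.
  by rewrite !big_cons IH; congr (_, _) => /=; rewrite scaler0 addr0.
by rewrite E1 E2; congr (_, _) => /=; rewrite ?addr0 ?add0r.
Qed.

Lemma diff_coords V W (f : V -> W) (I : finType) (e : I -> V) (c : I -> {linear V -> R^o}) z h :
  (forall w, w = \sum_i c i w *: e i) -> differentiable f z ->
  'd f z h = \sum_i c i h *: 'D_(e i) f z.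
Proof.
move=> ce df; rewrite {1}(ce h) linear_sum; apply: eq_bigr => i _.
by rewrite linearZ deriveE.
Qed.

Lemma Ck_diff V W k (A : set V) (f : V -> W) (v : V -> V) : has_coords V -> open A ->
  Ck k.+1 A f -> Ck k A v -> Ck k A (fun z => 'd f z (v z)).
Proof.
move=> [I [e [c [cc ce]]]] oA [df Df] cv.
apply: (@Ck_eq _ _ _ _ (fun z => \sum_i (c i (v z) : R^o) *: 'D_(e i) f z)) => // [z Az|].
  by rewrite (diff_coords _ ce) //; exact: df.
by apply: Ck_sum => // i; apply: CkZ => //; [exact: (@Ck_linear_comp _ _ _ _ _ _ (c i))|exact: Df].
Qed.

(** The induction keeps [f] fixed and varies [g]: the chain rule leaves the functions ['D_(e i) g]
    composed with the same [f]. *)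
Lemma Ck_comp V W U k (A : set V) (B : set W) (f : V -> W) (g : W -> U) : has_coords W ->
  open A -> (forall z, A z -> B (f z)) -> Ck k A f -> Ck k B g ->
  Ck k A (fun z => g (f z)).
Proof.
move=> [I [e [c [cc ce]]]] oA AB; elim: k g => [|k IH] g.
  move=> cf cg z Az; apply: continuous_comp; first exact: cf.
  by apply: cg; exact: AB.
move=> cf; have cf' := Ck_pred cf; move: cf => [df Df] [dg Dg].
have D z v : A z -> has_diff (fun z => g (f z)) z v ('d g (f z) ('D_v f z)).
  move=> Az; rewrite deriveE; last exact: df.
  apply: (has_diff_comp (has_diff_diff _ (df _ Az))).
  by apply: has_diff_diff; apply: dg; exact: AB.
split=> [z Az|v]; first by case: (D z 0 Az).
apply: (@Ck_eq _ _ _ _ (fun z => \sum_i (c i ('D_v f z) : R^o) *: 'D_(e i) g (f z))) => // [z Az|].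
  rewrite [RHS]deriveE; last by case: (D z 0 Az).
  case: (D z v Az) => _ ->; rewrite [RHS](diff_coords _ ce) //.
  by apply: dg; exact: AB.
by apply: Ck_sum => // i; apply: CkZ => //; [exact: (@Ck_linear_comp _ _ _ _ _ _ (c i) oA (cc i)
  (Df v))|exact: (IH _ cf' (Dg _))].
Qed.

Lemma Ck_fst V W U k (A : set V) (f : V -> W * U) : open A ->
  Ck k A f -> Ck k A (fun z => (f z).1).
Proof. by move=> oA; apply: (@Ck_linear_comp _ _ _ _ _ _ fst) => // x; exact: cvg_fst. Qed.

Lemma Ck_snd V W U k (A : set V) (f : V -> W * U) : open A ->
  Ck k A f -> Ck k A (fun z => (f z).2).
Proof. by move=> oA; apply: (@Ck_linear_comp _ _ _ _ _ _ snd) => // x; exact: cvg_snd. Qed.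

Lemma Ck_pair V W U k (A : set V) (f : V -> W) (g : V -> U) : open A ->
  Ck k A f -> Ck k A g -> Ck k A (fun z => (f z, g z) : (W * U)%type).
Proof.
move=> oA; elim: k f g => [|k IH] f g /=.
  by move=> cf cg z Az; apply: cvg_pair; [exact: cf|exact: cg].
move=> [df Df] [dg Dg]; split=> [z Az|v].
  by apply: differentiable_pair; [exact: df|exact: dg].
apply: Ck_eq (IH _ _ (Df v) (Dg v)) => // z Az.
have [dp E] := has_diff_pair (has_diff_diff v (df z Az)) (has_diff_diff v (dg z Az)).
by rewrite [RHS]deriveE // E !deriveE //; [exact: dg|exact: df].
Qed.

End Calculus.

(** * Symmetry of second derivatives *)

Section SecondDerivatives.
Variable R : realType.
Implicit Types U V W : normedModType R.

(** The [+ 1] keeps the denominator positive when [a] and [b] vanish, and makes the final estimate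
    strict. *)
Lemma ball_lincomb V (z a b : V) (s t e : R) : 0 < e ->
  `|s| < e / (`|a| + `|b| + 1) -> `|t| < e / (`|a| + `|b| + 1) ->
  ball z e (z + s *: a + t *: b).
Proof.
move=> e0; set r := e / _ => sr tr.
have p0 : 0 < `|a| + `|b| + 1 by rewrite ltr_wpDl // addr_ge0.
have r0 : 0 < r by rewrite divr_gt0.
rewrite -ball_normE /= opprD addrA opprD addrA subrr add0r.
rewrite -opprD normrN (le_lt_trans (ler_normD _ _)) // !normrZ.
have <- : r * (`|a| + `|b| + 1) = e by rewrite /r divfK // gt_eqF.
rewrite !mulrDr mulr1; apply: (@le_lt_trans _ _ (r * `|a| + r * `|b|)); last by rewrite ltrDl.
by apply: lerD; apply: ler_wpM2r => //; exact: ltW.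
Qed.

(** Schwarz's theorem. The second difference of [f] over the parallelogram spanned by [h *: v] and
    [h *: w] is symmetric in [v] and [w], and equals $h^2$ times either mixed derivative at some
    point of the parallelogram; continuity of both derivatives at [z] concludes as [h] shrinks. *)
Lemma symmetric_derivatives_scalar V (A : set V) (f : V -> R^o) z v w :
  open A -> A z -> Ck 2%N A f -> 'D_v ('D_w f) z = 'D_w ('D_v f) z.
Proof.
move=> oA Az cf.
have tri (e x y p q : R) : p = q -> `|y - p| < e / 2 -> `|x - q| < e / 2 -> `|x - y| <= e.
  move=> -> yq xq; have -> : x - y = (x - q) - (y - q) by rewrite opprB addrA subrK.
  apply: le_trans (ler_normB _ _) _; rewrite [leRHS]splitr.
  by apply: lerD; exact: ltW.
(* The mean value theorem, applied twice to the second difference. *)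
have mv (a b : V) : exists r : R, 0 < r /\ forall h : R, 0 < h -> h < r ->
    exists s t : R, [/\ 0 < s < h, 0 < t < h &
      f (z + h *: a + h *: b) - f (z + h *: a) - (f (z + h *: b) - f z) =
      h * (h * 'D_b ('D_a f) (z + s *: a + t *: b))].
  have [e /= e0 eA] := (nbhs_ballP _ _).1 (open_near oA Az).
  pose r := e / (`|a| + `|b| + 1).
  have r0 : 0 < r by rewrite divr_gt0 // ltr_wpDl // addr_ge0.
  have inA (s t : R) : `|s| < r -> `|t| < r -> A (z + s *: a + t *: b).
    by move=> sr tr; apply: eA; apply: ball_lincomb.
  exists r; split=> // h h0 hr.
  have line (F : V -> R^o) (y c : V) (x : R) : differentiable F (y + x *: c) ->
      is_derive x 1 (fun q : R => F (y + q *: c)) ('D_c F (y + x *: c)).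
    move=> dF.
    have hd : has_diff (fun q : R^o => F (y + q *: c)) x 1 ('D_c F (y + x *: c)).
      rewrite deriveE //; apply: (has_diff_comp (f := fun q : R^o => y + q *: c)); last first.
        by split.
      apply: (has_diff_eq (d := 0 + (x *: (0 : V) + 1 *: c))).
        by rewrite scaler0 scale1r !add0r.
      apply: has_diffD; first exact: has_diff_cst.
      by apply: has_diffZ; [exact: has_diff_id|exact: has_diff_cst].
    by case: hd => d1 d2; split; [exact: diff_derivable|rewrite deriveE].
  have [df Df] := cf.
  have lt_r (x : R) : x \in `[0, h] -> `|x| < r.
    by rewrite in_itv /= => /andP[x0 xh]; rewrite ger0_norm // (le_lt_trans xh).
  pose G (x : R) : R := f (z + x *: a + h *: b) - f (z + x *: a).
  have hh : `|h| < r by rewrite gtr0_norm.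
  have n0 : `|0 : R| < r by rewrite normr0.
  have dG (x : R) : x \in `[0, h] ->
      is_derive x 1 G ('D_a f (z + x *: a + h *: b) - 'D_a f (z + x *: a)).
    move=> /lt_r xr; apply: is_deriveB; last first.
      by apply: line; apply: df; have := inA _ _ xr n0; rewrite scale0r addr0.
    have := @line f (z + h *: b) a x; rewrite addrAC => L.
    have -> : (fun x0 : R => f (z + x0 *: a + h *: b)) = (fun q : R => f (z + h *: b + q *: a)).
      by apply/funext => q; rewrite addrAC.
    by apply: L; apply: df; apply: inA.
  have cont (F : R -> R) (dF : R -> R) : (forall x, x \in `[0, h] -> is_derive x 1 F (dF x)) ->
      {within `[0, h], continuous F}.
    by move=> d; apply: derivable_within_continuous => x /d [].
  have sub (x : R) : x \in `]0, h[ -> x \in `[0, h] by apply: subset_itv_oo_cc.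
  have [s s0 Es] := MVT h0 (fun x x0 => dG x (sub x x0)) (cont _ _ dG).
  pose H (x : R) : R := 'D_a f (z + s *: a + x *: b).
  have dH (x : R) : x \in `[0, h] -> is_derive x 1 H ('D_b ('D_a f) (z + s *: a + x *: b)).
    move=> /lt_r xr; apply: line; apply: (Df a).1; apply: inA => //; exact: lt_r (sub _ s0).
  have [t t0 Et] := MVT h0 (fun x x0 => dH x (sub x x0)) (cont _ _ dH).
  exists s, t; split; [by move: s0; rewrite in_itv|by move: t0; rewrite in_itv|].
  have -> : f (z + h *: a + h *: b) - f (z + h *: a) - (f (z + h *: b) - f z) = G h - G 0.
    by rewrite /G scale0r addr0.
  rewrite Es; have -> : 'D_a f (z + s *: a + h *: b) - 'D_a f (z + s *: a) = H h - H 0.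
    by rewrite /H scale0r addr0.
  by rewrite Et !subr0 mulrC [_ * h]mulrC.
have lim (a b : V) : forall e : R, 0 < e -> exists d : R, 0 < d /\ forall s t : R, `|s| < d ->
  `|t| < d ->
    `|'D_b ('D_a f) z - 'D_b ('D_a f) (z + s *: a + t *: b)| < e.
  move=> e e0.
  have c2 : {for z, continuous ('D_b ('D_a f))} by case: cf => _ /(_ a) [_ /(_ b)]; apply.
  have /(_ _ (nbhsx_ballx _ _ e0)) /nbhs_ballP [r /= r0 rA] := c2.
  pose d := r / (`|a| + `|b| + 1).
  have p0 : 0 < `|a| + `|b| + 1 by rewrite ltr_wpDl // addr_ge0.
  exists d; split=> [|s t sd td]; first by rewrite divr_gt0.
  by have /rA := @ball_lincomb _ z a b s t r r0 sd td; rewrite -ball_normE.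
apply/eqP; rewrite -subr_eq0 -normr_le0; apply/ler_addgt0Pl => e e0; rewrite addr0.
have e20 : 0 < e / 2 by rewrite divr_gt0.
have [r1 [r10 mv1]] := mv v w; have [r2 [r20 mv2]] := mv w v.
have [d1 [d10 l1]] := lim v w _ e20; have [d2 [d20 l2]] := lim w v _ e20.
(* [r1], [r2] bound the steps for which the mean value formula holds, [d1], [d2] those for which the
   mixed derivatives stay within [e / 2] of their values at [z]. *)
pose m := Num.min (Num.min r1 r2) (Num.min d1 d2).
have m0 : 0 < m by rewrite !lt_min r10 r20 d10 d20.
pose h := m / 2.
have h0 : 0 < h by rewrite divr_gt0.
have hm : h < m by rewrite ltr_pdivrMr // mulr_natr mulr2n ltrDl.
move: (hm); rewrite !lt_min => /andP[/andP[hr1 hr2] /andP[hd1 hd2]].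
have [s1 [t1 [s1h t1h E1]]] := mv1 _ h0 hr1.
have [s2 [t2 [s2h t2h E2]]] := mv2 _ h0 hr2.
have zvw : z + h *: w + h *: v = z + h *: v + h *: w by rewrite addrAC.
have alg (p x y q : R) : p - x - (y - q) = p - y - (x - q).
  by rewrite !opprB addrACA [RHS]addrACA [- x + _]addrC.
(* Exchanging [v] and [w] only regroups the second difference, so its two mean value forms agree. *)
have E12 : h * (h * ('D_w ('D_v f) (z + s1 *: v + t1 *: w) : R)) =
    h * (h * ('D_v ('D_w f) (z + s2 *: w + t2 *: v) : R)).
  move: E2; rewrite zvw => E2.
  by refine (Logic.eq_trans (Logic.eq_sym E1) (Logic.eq_trans _ E2)); exact: alg.
have E : 'D_w ('D_v f) (z + s1 *: v + t1 *: w) = 'D_v ('D_w f) (z + s2 *: w + t2 *: v).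
  exact: (mulfI (lt0r_neq0 h0) (mulfI (lt0r_neq0 h0) E12)).
have bnd (x : R) d : 0 < x < h -> h < d -> `|x| < d.
  by move=> /andP[x0 xh] hd; rewrite (gtr0_norm x0); exact: lt_trans xh hd.
exact: tri E (l1 s1 t1 (bnd _ _ s1h hd1) (bnd _ _ t1h hd1))
  (l2 s2 t2 (bnd _ _ s2h hd2) (bnd _ _ t2h hd2)).
Qed.

Lemma symmetric_derivatives V W (A : set V) (f : V -> W) z v w : has_coords W ->
  open A -> A z -> Ck 2%N A f -> 'D_v ('D_w f) z = 'D_w ('D_v f) z.
Proof.
move=> [I [e [c [cc ce]]]] oA Az cf.
apply: etrans (ce _) _; apply: esym; apply: etrans (ce _) _.
apply: eq_bigr => i _; apply: (congr1 (fun k : R^o => k *: e i)); apply: esym.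
have D1 a y : A y -> c i ('D_a f y) = 'D_a (fun x => c i (f x) : R^o) y.
  move=> Ay; have dy : differentiable f y by apply: cf.1.
  have [d E] := has_diff_linear (cc i) (has_diff_diff a dy).
  by rewrite !deriveE // E.
have D2 a b : c i ('D_b ('D_a f) z) = 'D_b ('D_a (fun x => c i (f x) : R^o)) z.
  have dy : differentiable ('D_a f) z by apply: (cf.2 a).1.
  have [d E] := has_diff_linear (cc i) (has_diff_diff b dy).
  rewrite deriveE // -E -deriveE //; apply: near_eq_derive.
  by apply: filterS (open_near oA Az) => y /D1.
rewrite !D2; apply: (symmetric_derivatives_scalar _ _ oA Az).
exact: Ck_linear_comp.
Qed.

(** Product rule for evaluating a differential on a moving vector: one term differentiates [f] again
    with the vector frozen at [v z], the other takes the variation of the vector. Expanding in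
    coordinates avoids differentiating ['d f] as an operator-valued map. *)
Lemma has_diff_diff_apply V W (A : set V) (f : V -> W) (v : V -> V) z h dv :
  has_coords V -> open A -> A z -> Ck 2%N A f -> has_diff v z h dv ->
  has_diff (fun y => 'd f y (v y)) z h ('D_h ('D_(v z) f) z + 'd f z dv).
Proof.
move=> [I [e [c [cc ce]]]] oA Az cf hv.
apply: (has_diff_near (f := fun y => \sum_i (c i (v y) : R^o) *: 'D_(e i) f y)).
  apply: filterS (open_near oA Az) => y Ay; rewrite -(diff_coords _ ce) //; exact: cf.1.
have dsum (r : seq I) (g : I -> V -> W) (d : I -> W) : (forall i, has_diff (g i) z h (d i)) ->
    has_diff (fun y => \sum_(i <- r) g i y) z h (\sum_(i <- r) d i).
  move=> gd; elim: r => [|i r IH].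
    under eq_fun do rewrite big_nil; rewrite big_nil; exact: has_diff_cst.
  by under eq_fun do rewrite big_cons; rewrite big_cons; exact: has_diffD.
have D2 i : differentiable ('D_(e i) f) z by apply: (cf.2 (e i)).1.
apply: has_diff_eq (dsum _ _ _ (fun i => has_diffZ (has_diff_linear (cc i) hv) (has_diff_diff h
  (D2 i)))).
rewrite big_split /= -(diff_coords _ ce); last exact: cf.1.
congr (_ + _).
have -> : 'D_h ('D_(v z) f) z = 'D_h (fun y => \sum_i (c i (v z) : R^o) *: 'D_(e i) f y) z.
  apply: near_eq_derive; apply: filterS (open_near oA Az) => y Ay.
  by rewrite -(diff_coords _ ce) ?deriveE //; exact: cf.1.
have [d E] := dsum (index_enum I) _ _ (fun i => has_diffZ
  (has_diff_cst (c i (v z) : R^o) z h) (has_diff_diff h (D2 i))).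
apply: esym; apply: etrans (deriveE _ d) _; apply: etrans E _; apply: eq_bigr => i _.
by rewrite scale0r addr0.
Qed.

Definition lie V (X Y : V -> V) z := 'd Y z (X z) - 'd X z (Y z).

(* The Lie bracket is natural under a change of coordinates: the second
   derivatives of [phi] cancel by symmetry. *)
Lemma lie_change V (A : set V) (phi X Y X' Y' : V -> V) z :
  has_coords V -> open A -> A z -> Ck 2%N A phi ->
  differentiable X z -> differentiable Y z ->
  differentiable X' (phi z) -> differentiable Y' (phi z) ->
  (forall y, A y -> X' (phi y) = 'd phi y (X y)) ->
  (forall y, A y -> Y' (phi y) = 'd phi y (Y y)) ->
  lie X' Y' (phi z) = 'd phi z (lie X Y z).
Proof.
move=> cV oA Az cphi dX dY dX' dY' EX EY.
have D (F F' : V -> V) h : differentiable F z -> differentiable F' (phi z) ->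
    (forall y, A y -> F' (phi y) = 'd phi y (F y)) ->
    'd F' (phi z) ('d phi z h) = 'D_h ('D_(F z) phi) z + 'd phi z ('d F z h).
  move=> dF dF' EF.
  have [_ <-] := has_diff_diff_apply cV oA Az cphi (has_diff_diff h dF).
  have hF : has_diff (fun y => F' (phi y)) z h ('d F' (phi z) ('d phi z h)).
    apply: has_diff_comp (has_diff_diff _ dF'); apply: has_diff_diff; exact: cphi.1.
  have [|_ ->] // := has_diff_near (g := fun y => 'd phi y (F y)) _ hF.
  by apply: filterS (open_near oA Az) => y /EF.
rewrite /lie (EX _ Az) (EY _ Az) (D _ _ _ dY dY' EY) (D _ _ _ dX dX' EX) linearB /=
  (symmetric_derivatives _ _ cV oA Az cphi).
by rewrite opprD addrACA subrr add0r.
Qed.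

End SecondDerivatives.

(** * Functions, vector fields and tensors on an atlas *)

(** Common interface of the atlas of $M$ and the adapted atlas of $E$: the same Jacobian lemmas
    build tangent vectors of $M$ and transform fields on $E$. *)
Record smooth_atlas (R : realType) (T : Type) (V : normedModType R)
    (A : charting T V) : Prop := {
  atlas_has_coords : has_coords V;
  atlas_inj : forall (a : idx A) p q, dom a p -> dom a q -> coord a p = coord a q -> p = q;
  atlas_open : forall a : idx A, chart_open A (dom a);
  atlas_smooth : forall a b : idx A,
    Cinf (coord a @` (dom b `&` dom a)) (transition a b) }.

(** Only injectivity of the chart is assumed, because the lemma also serves to compute the adapted
    transitions, before the adapted atlas is known to be smooth. *)
Lemma local_rep_inj (R : realType) (T : Type) (V Z : normedModType R) (A : charting T V)
    (a : idx A) (g : T -> Z) e :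
  (forall p q, dom a p -> dom a q -> coord a p = coord a q -> p = q) ->
  dom a e -> local_rep a g (coord a e) = g e.
Proof.
move=> inj ae; rewrite /local_rep; case: xgetP => [y _ [e' [ae' E ->]]|/(_ (g e)) []].
  by rewrite (inj _ _ ae' ae E).
by exists e.
Qed.

Section Atlas.
Variables (R : realType) (T : Type) (V : normedModType R) (A : charting T V).
Hypothesis hA : smooth_atlas A.
Implicit Types (a b c : idx A) (e : T) (W : set T) (X Y : vfield A) (Z : normedModType R).

Local Notation img a W := (coord a @` (W `&` dom a)).

Definition jac a b e : {linear V -> V} := 'd (transition a b) (coord a e).

Lemma img_coord W a e : W e -> dom a e -> img a W (coord a e).
Proof. by exists e. Qed.

Lemma chart_openT : chart_open A setT.
Proof. by move=> a; have := atlas_open hA a a; rewrite setIid setTI. Qed.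

Lemma chart_openI W W' : chart_open A W -> chart_open A W' -> chart_open A (W `&` W').
Proof.
move=> oW oW' a.
have -> : img a (W `&` W') = img a W `&` img a W'; last exact: openI.
rewrite eqEsubset; split=> [z [e [[We W'e] ae] <-]|z [[e [We ae] <-] [e' [W'e ae'] E]]].
  by split; exists e.
have E' : e' = e by apply: (atlas_inj hA) ae' ae E.
by exists e => //; split=> //; split=> //; rewrite -E'.
Qed.

Lemma local_rep_coord Z a (g : T -> Z) e : dom a e -> local_rep a g (coord a e) = g e.
Proof. by apply: local_rep_inj; exact: atlas_inj. Qed.

Lemma near_img W a e (P : V -> Prop) : chart_open A W -> W e -> dom a e ->
  (forall e', W e' -> dom a e' -> P (coord a e')) -> \forall z \near coord a e, P z.
Proof.
move=> oW We ae PW; apply: filterS (open_near (oW a) (img_coord We ae)).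
by move=> z [e' [We' ae'] <-]; apply: PW.
Qed.

Lemma transition_coord a b e : dom a e -> transition a b (coord a e) = coord b e.
Proof. exact: local_rep_coord. Qed.

Lemma local_rep_transition Z a b (g h : T -> Z) e : dom a e -> dom b e -> g e = h e ->
  local_rep b g (transition a b (coord a e)) = local_rep a h (coord a e).
Proof. by move=> ae be gh; rewrite transition_coord // !local_rep_coord. Qed.

Lemma transition_differentiable a b e : dom a e -> dom b e ->
  differentiable (transition a b) (coord a e).
Proof. by move=> ae be; apply: Ck_differentiable (atlas_smooth hA a b 1%N) _; exists e. Qed.

Lemma jac_comp a b c e v : dom a e -> dom b e -> dom c e ->
  jac b c e (jac a b e v) = jac a c e v.
Proof.
move=> ae be ce.
have h1 := has_diff_diff v (transition_differentiable ae be).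
have := has_diff_diff (jac a b e v) (transition_differentiable be ce).
rewrite -{1}(transition_coord b ae) => h2.
have [] // := has_diff_near (g := transition a c) _ (has_diff_comp h1 h2).
apply: (near_img (chart_openI (atlas_open hA b) (atlas_open hA c)) (conj be ce) ae).
by move=> e' [be' ce'] ae'; rewrite !transition_coord.
Qed.

Lemma jac_id a e v : dom a e -> jac a a e v = v.
Proof.
move=> ae; have [] // := has_diff_near (g := transition a a) _ (has_diff_id (coord a e) v).
apply: (near_img (atlas_open hA a) ae ae) => e' ae' _; exact/esym/transition_coord.
Qed.

Lemma smooth_onP Z W (g : idx A -> T -> Z) (h : idx A -> V -> Z) : chart_open A W ->
  (forall a, Cinf (img a W) (h a)) ->
  (forall a e, W e -> dom a e -> g a e = h a (coord a e)) -> smooth_on W g.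
Proof.
move=> oW ch gh a k; apply: Ck_eq (ch a k); first exact: oW.
by move=> z [e [We ae] <-]; rewrite local_rep_coord // gh.
Qed.

Lemma smooth_on_eq Z W (g h : idx A -> T -> Z) : chart_open A W ->
  (forall a e, W e -> dom a e -> g a e = h a e) -> smooth_on W g -> smooth_on W h.
Proof.
move=> oW gh sg; apply: (smooth_onP oW sg) => a e We ae.
by rewrite local_rep_coord // gh.
Qed.

Lemma smooth_on_subset Z W W' (g : idx A -> T -> Z) :
  W' `<=` W -> smooth_on W g -> smooth_on W' g.
Proof.
move=> WW sg a k; apply: Ck_subset (sg a k).
by move=> z [e [We ae] <-]; exists e => //; split=> //; apply: WW.
Qed.

Lemma smooth_on_differentiable Z W (g : idx A -> T -> Z) a e : smooth_on W g ->
  W e -> dom a e -> differentiable (local_rep a (g a)) (coord a e).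
Proof. by move=> sg We ae; apply: Ck_differentiable (sg a 1%N) _; exact: img_coord. Qed.

(** Expressions such as [deriv_fun X f] and [dt_of Y] are indexed by charts, so independence of the
    chart has to be carried along with smoothness. *)
Definition scalar_field W (f : idx A -> T -> R) : Prop :=
  (forall a b e, W e -> dom a e -> dom b e -> f a e = f b e) /\ smooth_on (Z := R^o) W f.

Lemma scalar_field_fun W (f : T -> R) : smooth_fun_on A W f -> scalar_field W (fun=> f).
Proof. by []. Qed.

Lemma vector_field_subset W W' X : W' `<=` W -> vector_field W X -> vector_field W' X.
Proof.
move=> WW [tX sX]; split; last exact: smooth_on_subset sX.
by move=> e /WW; apply: tX.
Qed.

Lemma vector_field_eq W X Y : chart_open A W -> vf_eq W X Y -> vector_field W X -> vector_field W Y.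
Proof.
move=> oW XY [tX sX]; split; last by apply: smooth_on_eq sX.
by move=> e We a b ae be; rewrite -!XY //; apply: tX.
Qed.

Lemma vector_field_add W X Y : chart_open A W ->
  vector_field W X -> vector_field W Y -> vector_field W (vf_add X Y).
Proof.
move=> oW [tX sX] [tY sY]; split.
  by move=> e We a b ae be; rewrite /vf_add (tX e We a b) // (tY e We a b) // linearD.
apply: smooth_onP oW (fun a k => CkD (oW a) (sX a k) (sY a k)) _ => a e We ae.
by rewrite !local_rep_coord.
Qed.

Lemma vector_field_sub W X Y : chart_open A W ->
  vector_field W X -> vector_field W Y -> vector_field W (vf_sub X Y).
Proof.
move=> oW [tX sX] [tY sY]; split.
  by move=> e We a b ae be; rewrite /vf_sub (tX e We a b) // (tY e We a b) // linearB.
apply: smooth_onP oW (fun a k => CkB (oW a) (sX a k) (sY a k)) _ => a e We ae.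
by rewrite !local_rep_coord.
Qed.

Lemma vector_field_scale W f X : chart_open A W ->
  scalar_field W f -> vector_field W X -> vector_field W (vf_scale f X).
Proof.
move=> oW [cf sf] [tX sX]; split.
  by move=> e We a b ae be; rewrite /vf_scale (tX e We a b) // linearZ (cf b a).
apply: smooth_onP oW (fun a k => CkZ (oW a) (sf a k) (sX a k)) _ => a e We ae.
by rewrite !local_rep_coord.
Qed.

Lemma vector_field_0 W : chart_open A W -> vector_field W ((fun=> fun=> 0) : vfield A).
Proof.
move=> oW; split; first by move=> e We a b ae be; rewrite linear0.
by apply: (smooth_onP oW (fun a k => @Ck_cst _ _ _ k _ 0)).
Qed.

(** Makes the coefficients of a frame expansion, computed in the single chart [a], legitimate
    multipliers for a connection over [W]. *)
Lemma smooth_fun_of_chart W a (f : V -> R^o) : chart_open A W -> W `<=` dom a ->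
  Cinf (img a W) f -> smooth_fun_on A W (fun e => f (coord a e)).
Proof.
move=> oW Wa cf; apply: (@smooth_onP R^o _ _ (fun b z => f (transition b a z))) => //.
  move=> b k; apply: (Ck_comp (atlas_has_coords hA) (oW b) _ _ (cf k)).
    by move=> z [e [We be] <-]; rewrite transition_coord //; apply: img_coord => //; exact: Wa.
  by apply: Ck_subset (atlas_smooth hA b a k) => z [e [We be] <-]; exists e => //; split=> //;
    exact: Wa.
by move=> b e We be; rewrite transition_coord.
Qed.

(** A frame field is prescribed in one chart only, but a field needs components in every overlapping
    chart; the Jacobians supply them. *)
Definition field_of_chart a (X : V -> V) : vfield A := fun b e => jac a b e (X (coord a e)).

Lemma field_of_chartE a (X : V -> V) e : dom a e -> field_of_chart a X a e = X (coord a e).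
Proof. by move=> ae; rewrite /field_of_chart jac_id. Qed.

Lemma vector_field_of_chart W a (X : V -> V) : chart_open A W -> W `<=` dom a ->
  Cinf (img a W) X -> vector_field W (field_of_chart a X).
Proof.
move=> oW Wa cX; split.
  move=> e We b c be ce; rewrite /field_of_chart -[RHS]/(jac b c e _).
  by rewrite jac_comp //; exact: Wa.
apply: (@smooth_onP _ _ _ (fun b z => 'd (transition a b) (transition b a z) (X (transition b a
  z)))) => //; last first.
  by move=> b e We be; rewrite transition_coord.
move=> b k; have oWb : chart_open A (dom b `&` W) by apply: chart_openI => //; exact: atlas_open.
(* In chart [b] the field is [F] composed with the transition from [b] back to [a], and [F] is
   smooth on the overlap. *)
pose F z := 'd (transition a b) z (X z).
have cF : Ck k (img a (dom b `&` W)) F.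
  apply: (Ck_diff (atlas_has_coords hA) (oWb a)).
    by apply: Ck_subset (atlas_smooth hA a b k.+1) => z [e [[be We] ae] <-]; exists e.
  by apply: Ck_subset (cX k) => z [e [[be We] ae] <-]; exists e.
apply: (Ck_comp (atlas_has_coords hA) (oW b) _ _ cF).
  move=> z [e [We be] <-]; rewrite transition_coord //; apply: img_coord => //; exact: Wa.
by apply: Ck_subset (atlas_smooth hA b a k) => z [e [We be] <-]; exists e => //; split=> //;
  exact: Wa.
Qed.

Lemma bracketE X Y a e : dom a e ->
  bracket X Y a e = lie (local_rep a (X a)) (local_rep a (Y a)) (coord a e).
Proof. by move=> ae; rewrite /lie !local_rep_coord. Qed.

Lemma along_smooth Z W X (g : idx A -> T -> Z) : chart_open A W ->
  smooth_on W X -> smooth_on W g -> smooth_on W (along X g).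
Proof.
move=> oW sX sg.
apply: smooth_onP oW (fun a k => Ck_diff (atlas_has_coords hA) (oW a) (sg a k.+1) (sX a k)) _.
by move=> a e We ae; rewrite local_rep_coord.
Qed.

Lemma vector_field_bracket W X Y : chart_open A W ->
  vector_field W X -> vector_field W Y -> vector_field W (bracket X Y).
Proof.
move=> oW [tX sX] [tY sY]; split; last first.
  have s1 := along_smooth oW sX sY; have s2 := along_smooth oW sY sX.
  apply: smooth_onP oW (fun a k => CkB (oW a) (s1 a k) (s2 a k)) _ => a e We ae.
  by rewrite !local_rep_coord.
move=> e We a b ae be; rewrite !bracketE // -{1}(transition_coord b ae).
have oWb : chart_open A (dom b `&` W) by apply: chart_openI => //; exact: atlas_open.
have d F : smooth_on W F -> differentiable (local_rep a (F a)) (coord a e) /\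
    differentiable (local_rep b (F b)) (transition a b (coord a e)).
  by move=> sF; rewrite transition_coord //; split; exact: smooth_on_differentiable sF We _.
have t (F : vfield A) : (forall e, W e -> tangent_components e (F^~ e)) ->
    forall z, img a (dom b `&` W) z ->
    local_rep b (F b) (transition a b z) = 'd (transition a b) z (local_rep a (F a) z).
  move=> tF z [e' [[be' We'] ae'] <-].
  by rewrite transition_coord // !local_rep_coord //; exact: tF.
have [dXa dXb] := d _ _ sX; have [dYa dYb] := d _ _ sY.
apply: (lie_change (atlas_has_coords hA) (oWb a)) => //; [exact: img_coord| |exact: t|exact: t].
by apply: Ck_subset (atlas_smooth hA a b 2%N) => z [e' [[be' We'] ae'] <-]; exists e'.
Qed.

Lemma scalar_field_deriv W X f : chart_open A W ->
  vector_field W X -> scalar_field W f -> scalar_field W (deriv_fun X f).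
Proof.
move=> oW [tX sX] [cf sf]; split; last exact: (@along_smooth R^o).
move=> b a e We be ae.
have df c : dom c e -> differentiable (local_rep (Z := R^o) c (f c)) (coord c e).
  by move=> ce; exact: smooth_on_differentiable sf We ce.
have h1 := has_diff_diff (X a e) (transition_differentiable ae be).
rewrite /deriv_fun /along (tX e We a b ae be) -(transition_coord b ae).
have := df b be; rewrite -(transition_coord b ae) => dfb.
have [|_ <-] // := has_diff_near (g := local_rep (Z := R^o) a (f a)) _
  (has_diff_comp h1 (has_diff_diff _ dfb)).
apply: (near_img (chart_openI (atlas_open hA b) oW) (conj be We) ae).
move=> e' [be' We'] ae'; apply: local_rep_transition => //; exact: cf.
Qed.

Lemma along_eq Z W X X' (g g' : idx A -> T -> Z) a e : chart_open A W -> W e -> dom a e ->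
  X a e = X' a e -> (forall e, W e -> dom a e -> g a e = g' a e) -> smooth_on W g ->
  along X g a e = along X' g' a e.
Proof.
move=> oW We ae EX Eg sg; rewrite /along EX.
have [|_ ->] // := near_eq_differentiable (g := local_rep a (g' a)) _ (smooth_on_differentiable
  sg We ae).
apply: (near_img oW We ae) => e' We' ae'.
by rewrite !local_rep_coord // Eg.
Qed.

Lemma bracket_eq W X X' Y Y' a e : chart_open A W -> W e -> dom a e ->
  smooth_on W X -> smooth_on W Y -> vf_eq W X X' -> vf_eq W Y Y' ->
  bracket X Y a e = bracket X' Y' a e.
Proof.
move=> oW We ae sX sY EX EY; rewrite /bracket.
rewrite (along_eq (X' := X') (g' := Y') oW We ae (EX _ _ We ae) _ sY) => [|e' We' ae'].
  rewrite (along_eq (X' := Y') (g' := X') oW We ae (EY _ _ We ae) _ sX) // => e' We' ae'.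
  exact: EX.
exact: EY.
Qed.

Lemma along_addr Z W X (g h : idx A -> T -> Z) a e : chart_open A W -> W e -> dom a e ->
  smooth_on W g -> smooth_on W h ->
  along X (fun a e => g a e + h a e) a e = along X g a e + along X h a e.
Proof.
move=> oW We ae sg sh.
have [|_ E] := has_diff_near (g := local_rep a (fun e => g a e + h a e)) _ (has_diffD
  (has_diff_diff (X a e) (smooth_on_differentiable sg We ae))
  (has_diff_diff (X a e) (smooth_on_differentiable sh We ae))).
  by apply: (near_img oW We ae) => e' We' ae'; rewrite !local_rep_coord.
by rewrite /along E.
Qed.

Lemma along_scaler Z W X f (g : idx A -> T -> Z) a e : chart_open A W -> W e -> dom a e ->
  smooth_on (Z := R^o) W f -> smooth_on W g ->
  along X (fun a e => f a e *: g a e) a e =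
  f a e *: along X g a e + deriv_fun X f a e *: g a e.
Proof.
move=> oW We ae sf sg.
have [|_ E] := has_diff_near (g := local_rep a (fun e => f a e *: g a e)) _ (has_diffZ
  (has_diff_diff (X a e) (smooth_on_differentiable sf We ae))
  (has_diff_diff (X a e) (smooth_on_differentiable sg We ae))).
  by apply: (near_img oW We ae) => e' We' ae'; rewrite !local_rep_coord.
by rewrite /along E !local_rep_coord.
Qed.

Lemma bracketC X Y a e : bracket Y X a e = - bracket X Y a e.
Proof. by rewrite /bracket opprB. Qed.

Lemma bracket_addr W X Y Y' a e : chart_open A W -> W e -> dom a e ->
  smooth_on W Y -> smooth_on W Y' ->
  bracket X (vf_add Y Y') a e = bracket X Y a e + bracket X Y' a e.
Proof.
move=> oW We ae sY sY'; rewrite /bracket.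
rewrite [along X _ a e](along_addr X oW We ae sY sY').
have -> : along (vf_add Y Y') X a e = along Y X a e + along Y' X a e by rewrite /along linearD.
by rewrite opprD addrACA.
Qed.

Lemma bracket_scaler W X f Y a e : chart_open A W -> W e -> dom a e ->
  smooth_on (Z := R^o) W f -> smooth_on W Y ->
  bracket X (vf_scale f Y) a e = f a e *: bracket X Y a e + deriv_fun X f a e *: Y a e.
Proof.
move=> oW We ae sf sY; rewrite /bracket.
rewrite [along X _ a e](along_scaler X oW We ae sf sY) {2}/along /vf_scale linearZ.
by rewrite scalerBr addrAC.
Qed.

(* A (1,1) tensor field, given by its endomorphisms [L a e] in each chart. *)
Record tensor_field (L : idx A -> T -> V -> V) : Prop := {
  tensor_linear : forall a e, linear (L a e);
  tensor_natural : forall a b e v, dom a e -> dom b e ->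
    L b e (jac a b e v) = jac a b e (L a e v);
  tensor_smooth : forall W X, chart_open A W -> smooth_on W X ->
    smooth_on W (fun a e => L a e (X a e)) }.

Lemma vector_field_tensor L W X : tensor_field L -> chart_open A W ->
  vector_field W X -> vector_field W (fun a e => L a e (X a e)).
Proof.
move=> tL oW [tX sX]; split; last exact: tensor_smooth.
move=> e We a b ae be; rewrite (tX e We a b ae be); exact: tensor_natural.
Qed.

End Atlas.

(** * The adapted atlas *)

Section AdaptedAtlas.
Variables (R : realType) (n : nat) (M : smooth_manifold R n).
Local Notation E := (evolution_space M).

Lemma has_coords_ecoord : has_coords (ecoord R n).
Proof.
apply: (@has_coords_prod R (R^o * 'rV[R]_n)%type).
  by apply: has_coords_prod; [exact: has_coordsR|exact: has_coords_rV].
exact: has_coords_rV.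
Qed.

Lemma manifold_atlas : smooth_atlas (mcharts M).
Proof.
split=> [|a p q ap aq|a b|a b]; first exact: has_coords_rV.
- by apply: mfd_coord_inj; rewrite inE.
- by apply: mfd_coord_open; exact: mfd_dom_open.
- by rewrite setIC; exact: mfd_transition_smooth.
Qed.

Local Notation hM := manifold_atlas.

Lemma tangent_eq (v w : tangent_bundle M) : foot v = foot w -> comp v =1 comp w -> v = w.
Proof.
case: v w => [p u uo uc] [q w wo wc] /= pq /funext uw.
by case: q / pq wo wc => wo wc; case: w / uw wo wc => wo wc; congr Tangent; exact: Prop_irrelevance.
Qed.

(** Every row vector occurs as the components of a tangent vector, so the images of adapted charts
    are full in the fibre direction and hence open. Compatibility of the transported components is
    the cocycle rule for Jacobians; the value 0 off the chart domains is imposed by [comp_out]. *)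
Lemma tangent_exists (a : idx (mcharts M)) p u : dom a p ->
  exists v : tangent_bundle M, foot v = p /\ comp v a = u.
Proof.
move=> ap.
pose c b := if pselect (dom b p) then jac a b p u else 0.
have co b : ~ dom b p -> c b = 0 by rewrite /c; case: pselect.
have cE b : dom b p -> c b = jac a b p u by rewrite /c; case: pselect.
clearbody c.
have cc : tangent_components p c.
  by move=> b d bp dp; rewrite (cE b bp) (cE d dp); exact/esym/(jac_comp hM).
by exists (Tangent co cc); split=> //=; rewrite cE // (jac_id hM).
Qed.

Lemma adapted_inj (a : idx (adapted M)) (e e' : E) : dom a e -> dom a e' ->
  coord a e = coord a e' -> e = e'.
Proof.
case: e e' => [t v] [t' v'] /= av av' [-> Ex Eu]; congr (_, _).
have Ep : foot v = foot v' by exact: (atlas_inj hM av av' Ex).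
apply: tangent_eq => // b.
have [bv|bv] := pselect (dom b (foot v)); last by rewrite !comp_out // -Ep.
by rewrite (comp_compat av bv) (@comp_compat _ _ _ _ v' a b) -?Ep // Eu.
Qed.

Lemma adapted_imgE (a b : idx (adapted M)) :
  coord a @` (dom b `&` dom a) =
  [set z : ecoord R n | (@coord _ _ _ (mcharts M) a @` (@dom _ _ _ (mcharts M) b `&` @dom _ _ _
    (mcharts M) a)) z.1.2].
Proof.
rewrite eqEsubset; split=> [z [[t v] /= [bv av] <-]|[[t x] u] /= [p [bp ap] <-]].
  by exists (foot v).
have [v [fv cv]] := tangent_exists u ap.
by exists (t, v); rewrite /= ?fv ?cv.
Qed.

Lemma continuous_position : continuous (fun z : ecoord R n => z.1.2).
Proof.
move=> z; apply: (@continuous_comp _ _ _ fst snd); [exact: cvg_fst|exact: cvg_snd].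
Qed.

Lemma adapted_img_open (a b : idx (adapted M)) : open (coord a @` (dom b `&` dom a)).
Proof.
rewrite adapted_imgE; apply: open_comp => [z _|]; first exact: continuous_position.
exact: (atlas_open hM).
Qed.

Local Notation mtransition := (@transition _ _ _ (mcharts M)).
Local Notation mimg a b := (@coord _ _ _ (mcharts M) a @` (@dom _ _ _ (mcharts M) b `&` @dom _ _
  _ (mcharts M) a)).

Lemma adapted_transition (a b : idx (adapted M)) (z : ecoord R n) :
  (coord a @` (dom b `&` dom a)) z ->
  transition a b z = (z.1.1, mtransition a b (z.1.2), 'd (mtransition a b) (z.1.2) z.2).
Proof.
move=> [e [be ae] <-].
rewrite [LHS](local_rep_inj (coord b) (@adapted_inj a) ae) /=.
by rewrite (transition_coord hM) // -(comp_compat ae be).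
Qed.

Lemma adapted_transition_smooth (a b : idx (adapted M)) :
  Cinf (coord a @` (dom b `&` dom a)) (transition a b).
Proof.
move=> k; have oA := @adapted_img_open a b.
set A := (_ @` _) in oA *.
have cp j : Ck j A (fun z : ecoord R n => z.1.2).
  by apply: Ck_snd => //; apply: Ck_fst => //; exact: Ck_id.
have maps z : A z -> mimg a b (z.1.2) by rewrite /A adapted_imgE.
have cphi j : Ck j A (fun z : ecoord R n => mtransition a b (z.1.2)).
  exact: (Ck_comp (has_coords_rV R n) oA maps (cp j) (atlas_smooth hM a b j)).
apply: (@Ck_eq _ _ _ _ _ (fun z : ecoord R n =>
  (z.1.1, mtransition a b (z.1.2), 'd (mtransition a b) (z.1.2) z.2) : ecoord R n)) => //.
  by move=> z /adapted_transition.
have cid j : Ck j A (fun z : ecoord R n => z) by exact: Ck_id.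
apply: Ck_pair => //; first apply: Ck_pair => //.
  by apply: Ck_fst => //; exact: Ck_fst.
(* The fibre component $d\varphi_x(u)$ is rewritten as the differential of $(t,x,u) \mapsto
   \varphi(x)$ in the direction $(0,u,0)$, so that [Ck_diff] applies on the whole coordinate
   space. *)
apply: (@Ck_eq _ _ _ _ _ (fun z : ecoord R n =>
  'd (fun z : ecoord R n => mtransition a b (z.1.2)) z (0, z.2, 0))) => //.
  move=> z Az; have dphi : differentiable (mtransition a b) (z.1.2).
    exact: Ck_differentiable (atlas_smooth hM a b 1%N) (maps _ Az).
  by have [_ ->] := has_diff_comp (has_diff_snd (has_diff_fst
    (has_diff_id z (0, z.2, 0)))) (has_diff_diff _ dphi).
apply: Ck_diff => //; first exact: has_coords_ecoord.
apply: Ck_pair => //; last exact: Ck_cst.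
by apply: Ck_pair => //; [exact: Ck_cst|exact: Ck_snd].
Qed.

Lemma adapted_atlas : smooth_atlas (adapted M).
Proof.
split=> [|a p q|a b|a b]; first exact: has_coords_ecoord.
- exact: adapted_inj.
- exact: adapted_img_open.
- exact: adapted_transition_smooth.
Qed.

Local Notation hE := adapted_atlas.

(** The fibre coordinate changes by $d\varphi_x(u)$, whose derivative in $x$ gives the second-order
    term. That term vanishes on vertical vectors and does not enter the time and position
    components. *)
Lemma adapted_jac (a b : idx (adapted M)) (e : E) (v : ecoord R n) :
  dom a e -> dom b e ->
  let phi := mtransition a b in let x := (coord a e).1.2 in
  jac a b e v = (v.1.1, 'd phi x v.1.2,
    'D_(v.1.2) ('D_((coord a e).2) phi) x + 'd phi x v.2).
Proof.
move=> ae be phi x; have oA := @adapted_img_open a b.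
have Ae : (coord a @` (dom b `&` dom a)) (coord a e) by exists e.
have dphi : differentiable phi x.
  apply: Ck_differentiable (atlas_smooth hM a b 1%N) _.
  by move: Ae; rewrite adapted_imgE.
suff key : has_diff (fun q : 'rV[R]_n * 'rV[R]_n => 'd phi (q.1) q.2)
    (x, (coord a e).2) (v.1.2, v.2) ('D_(v.1.2) ('D_((coord a e).2) phi) x + 'd phi x v.2).
  have hz := has_diff_id (coord a e) v.
  have [|_ <-] // := has_diff_near (g := transition a b) _ (has_diff_pair
    (has_diff_pair (has_diff_fst (has_diff_fst hz))
      (has_diff_comp (has_diff_snd (has_diff_fst hz)) (has_diff_diff _ dphi)))
    (has_diff_comp (has_diff_pair (has_diff_snd (has_diff_fst hz)) (has_diff_snd hz)) key)).
  by apply: filterS (open_near oA Ae) => z /adapted_transition.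
(* Base point and vector are separate factors of [q]; writing ['d phi q.1 q.2] as
   ['d Phi q (q.2, 0)] brings it to the form of [has_diff_diff_apply]. *)
pose Phi := fun q : 'rV[R]_n * 'rV[R]_n => phi q.1.
pose B : set ('rV[R]_n * 'rV[R]_n) := [set q | mimg a b q.1].
have oB : open B by apply: open_comp => [q _|]; [exact: cvg_fst|exact: (atlas_open hM)].
have Bx : B (x, (coord a e).2) by move: Ae; rewrite adapted_imgE.
have dPhi q u w : B q -> has_diff Phi q (u, w) ('d phi (q.1) u).
  move=> Bq; apply: (has_diff_comp (has_diff_fst (has_diff_id q (u, w)))).
  apply: has_diff_diff; exact: Ck_differentiable (atlas_smooth hM a b 1%N) Bq.
have cPhi : Ck 2%N B Phi.
  apply: (Ck_comp (has_coords_rV R n) oB (f := fst) (B := mimg a b)) => //; last exact: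
    (atlas_smooth hM).
  by apply: Ck_fst => //; exact: Ck_id.
have hh : has_diff (fun q : 'rV[R]_n * 'rV[R]_n => (q.2, 0 : 'rV[R]_n)) (x, (coord a e).2)
    (v.1.2, v.2) (v.2, 0).
  by apply: has_diff_pair; [exact: (has_diff_snd (has_diff_id _ _))|exact: has_diff_cst].
have H := has_diff_diff_apply (has_coords_prod (has_coords_rV R n) (has_coords_rV R n)) oB Bx
  cPhi hh.
have E1 : 'D_(v.1.2, v.2) ('D_((coord a e).2, 0) Phi) (x, (coord a e).2) =
    'D_(v.1.2) ('D_((coord a e).2) phi) x.
  have du : differentiable ('D_((coord a e).2) phi) x.
    exact: Ck_differentiable (Ck_derive (coord a e).2 (atlas_smooth hM a b 2%N)) (Bx : mimg a b x).
  have [|d E'] := has_diff_near (g := 'D_((coord a e).2, 0) Phi) _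
    (has_diff_comp (has_diff_fst (has_diff_id (x, (coord a e).2) (v.1.2, v.2))) (has_diff_diff _
      du)).
    apply: filterS (open_near oB Bx) => q Bq.
    have [d1 d2] := dPhi q (coord a e).2 0 Bq.
    rewrite [RHS]deriveE // d2 deriveE //.
    exact: Ck_differentiable (atlas_smooth hM a b 1%N) Bq.
  by rewrite deriveE // E' deriveE.
apply: (has_diff_eq (congr2 +%R E1 (dPhi _ v.2 0 Bx).2)); apply: has_diff_near H; apply: filterS
  (open_near oB Bx) => q Bq.
by have [_ ->] := dPhi q q.2 0 Bq.
Qed.

End AdaptedAtlas.

(** * Second-order fields in adapted coordinates *)

Section Semispray.
Variables (R : realType) (n : nat).
Local Notation E := (ecoord R n).
Local Notation rV := 'rV[R]_n.
Implicit Types (g x y : E -> E) (z v h : E) (w : rV) (A : set E).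

(* A second-order field in adapted coordinates, as a map on the open set [A]. *)
Record semispray A g : Prop := {
  semispray_open : open A;
  semispray_smooth : Cinf A g;
  semispray_position : forall z, A z -> (g z).1 = (1, z.2) }.

(** Index-free frame and coframe: [vert w] is $w^iV_i$ and [hor g z w] is $w^iH_i$, while [theta]
    and [psi] collect the $\theta^i$ and $\psi^i$ into row vectors. *)
Definition vert w : E := (0, 0, w).
Definition theta z v : rV := v.1.2 - v.1.1 *: z.2.
(* Gamma^i_j w^j, the coefficients being read off from the vertical derivative of
   [g]; [dnonlin] differentiates these coefficients in the direction [h]. *)
Definition nonlin g z w : rV := - 2^-1 *: ('d g z (vert w)).2.
Definition dnonlin g z w h : rV := - 2^-1 *: ('D_h ('D_(vert w) g) z).2.
Definition psi g z v : rV := v.2 - v.1.1 *: (g z).2 + nonlin g z (theta z v).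
Definition hor g z w : E := (0, w, - nonlin g z w).

(* S, Q and the projectors P_Gamma, P_V, P_H at [z], in adapted coordinates. *)
Definition local_S z v : E := vert (theta z v).
Definition local_Q g z v : E := hor g z (psi g z v).
Definition local_G g z v : E := v.1.1 *: g z.
Definition local_V g z v : E := vert (psi g z v).
Definition local_H g z v : E := hor g z (theta z v).

Lemma vert_linear : linear vert.
Proof. by move=> c w w'; rewrite /vert; congr (_, _, _) => /=; rewrite ?scaler0 ?addr0. Qed.

Lemma nonlin_linear g z : linear (nonlin g z).
Proof.
by move=> c w w'; rewrite /nonlin vert_linear linearP /= scalerDr !scalerA [_ * c]mulrC.
Qed.

Lemma nonlinD g z w w' : nonlin g z (w + w') = nonlin g z w + nonlin g z w'.
Proof. by rewrite -[w]scale1r nonlin_linear !scale1r. Qed.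

Lemma nonlinZ g z c w : nonlin g z (c *: w) = c *: nonlin g z w.
Proof.
have n0 : nonlin g z 0 = 0 by have := nonlin_linear g z (-1) 0 0; rewrite scaleN1r oppr0 addr0
  scaleN1r addNr.
by rewrite -[c *: w]addr0 nonlin_linear n0 addr0.
Qed.

Lemma nonlinN g z w : nonlin g z (- w) = - nonlin g z w.
Proof. by rewrite -scaleN1r nonlinZ scaleN1r. Qed.

Lemma theta_linear z : linear (theta z).
Proof. move=> c v v'; apply/rowP => i; rewrite !mxE /= -[c *: _]/(c * _); ring.
Qed.

Lemma psi_linear g z : linear (psi g z).
Proof.
move=> c v v'; rewrite /psi theta_linear nonlinD nonlinZ; apply/rowP => i.
rewrite !mxE /= -[c *: v.1.1]/(c * _); ring.
Qed.

Lemma hor_linear g z : linear (hor g z).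
Proof.
move=> c w w'; rewrite /hor; congr (_, _, _) => /=; first by rewrite scaler0 addr0.
by rewrite nonlinD nonlinZ opprD scalerN.
Qed.

Lemma local_S_linear z : linear (local_S z).
Proof. by move=> c v v'; rewrite /local_S theta_linear vert_linear. Qed.
Lemma local_Q_linear g z : linear (local_Q g z).
Proof. by move=> c v v'; rewrite /local_Q psi_linear hor_linear. Qed.
Lemma local_V_linear g z : linear (local_V g z).
Proof. by move=> c v v'; rewrite /local_V psi_linear vert_linear. Qed.
Lemma local_H_linear g z : linear (local_H g z).
Proof. by move=> c v v'; rewrite /local_H theta_linear hor_linear. Qed.
Lemma local_G_linear g z : linear (local_G g z).
Proof. by move=> c v v'; rewrite /local_G /= scalerDl scalerA. Qed.

Lemma theta_vert z w : theta z (vert w) = 0.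
Proof. by rewrite /theta /= scale0r subr0. Qed.

Lemma theta_hor g z w : theta z (hor g z w) = w.
Proof. by rewrite /theta /= scale0r subr0. Qed.

Lemma nonlin0 g z : nonlin g z 0 = 0.
Proof. by have := nonlinZ g z 0 0; rewrite !scale0r. Qed.

Lemma psi_vert g z w : psi g z (vert w) = w.
Proof. by rewrite /psi theta_vert nonlin0 /= scale0r subr0 addr0. Qed.

Lemma psi_hor g z w : psi g z (hor g z w) = 0.
Proof. by rewrite /psi theta_hor /= scale0r subr0 addNr. Qed.

Lemma diff_vert g z w : ('d g z (vert w)).2 = - (nonlin g z w *+ 2).
Proof.
rewrite /nonlin -scaler_nat scalerA mulrN divff ?pnatr_eq0 // scaleN1r opprK //.
Qed.

Section AtPoint.
Variables (A : set E) (g : E -> E).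
Hypothesis sg : semispray A g.
Let oA := semispray_open sg.

Lemma theta_semispray z : A z -> theta z (g z) = 0.
Proof. by move=> Az; rewrite /theta (semispray_position sg Az) /= scale1r subrr. Qed.

Lemma time_semispray z : A z -> (g z).1.1 = 1.
Proof. by move=> Az; rewrite (semispray_position sg Az). Qed.

Lemma semispray_decomp z v : A z -> v = local_G g z v + local_V g z v + local_H g z v.
Proof.
move=> Az; rewrite /local_G /local_V /local_H /psi /hor /theta.
case: (g z) (semispray_position sg Az) v => _ f /= -> [[t q] u] /=.
congr (_, _, _) => /=.
- by rewrite [t *: 1]mulr1 !addr0.
- by rewrite addr0 addrC subrK.
by rewrite addrA addrK addrC subrK.
Qed.

Lemma Ck_theta k x : Ck k A x -> Ck k A (fun q => theta q (x q)).
Proof.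
move=> cx; apply: CkB => //; first by apply: Ck_snd => //; exact: Ck_fst.
apply: (@CkZ _ _ _ _ _ (fun q => (x q).1.1 : R^o)) => //.
  by apply: Ck_fst => //; exact: Ck_fst.
by apply: Ck_snd => //; exact: Ck_id.
Qed.

Lemma Ck_vert k (w : E -> rV) : Ck k A w -> Ck k A (fun q => vert (w q)).
Proof. by move=> cw; apply: Ck_pair => //; exact: Ck_cst. Qed.

Lemma Ck_nonlin k (w : E -> rV) : Ck k A w -> Ck k A (fun q => nonlin g q (w q)).
Proof.
move=> cw; apply: CkZ => //; first exact: Ck_cst.
apply: Ck_snd => //; apply: Ck_diff => //; [exact: has_coords_ecoord|exact: (semispray_smooth sg)|].
exact: Ck_vert.
Qed.

Lemma Ck_psi k x : Ck k A x -> Ck k A (fun q => psi g q (x q)).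
Proof.
move=> cx; apply: CkD => //; last by apply: Ck_nonlin; exact: Ck_theta.
apply: CkB => //; first exact: Ck_snd.
apply: (@CkZ _ _ _ _ _ (fun q => (x q).1.1 : R^o)) => //.
  by apply: Ck_fst => //; exact: Ck_fst.
apply: Ck_snd => //; exact: (semispray_smooth sg).
Qed.

Lemma Ck_hor k (w : E -> rV) : Ck k A w -> Ck k A (fun q => hor g q (w q)).
Proof.
move=> cw; apply: Ck_pair => //; first by apply: Ck_pair => //; exact: Ck_cst.
by apply: CkN => //; exact: Ck_nonlin.
Qed.

Lemma Ck_local_G k x : Ck k A x -> Ck k A (fun q => local_G g q (x q)).
Proof.
move=> cx; apply: (@CkZ _ _ _ _ _ (fun q => (x q).1.1 : R^o)) => //.
  by apply: Ck_fst => //; exact: Ck_fst.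
exact: (semispray_smooth sg).
Qed.

Variables (z : E).
Hypothesis Az : A z.

Lemma semispray_differentiable : differentiable g z.
Proof. by apply: Ck_differentiable (semispray_smooth sg 1%N) Az. Qed.

Lemma diff_semispray h : ('d g z h).1 = (0, h.2).
Proof.
have [_ E1] := has_diff_fst (has_diff_diff h semispray_differentiable).
have [|_ E2] := has_diff_near (g := fun q => (g q).1) _ (has_diff_pair
  (has_diff_cst (1 : R^o) z h) (has_diff_snd (has_diff_id z h))).
  by apply: filterS (open_near oA Az) => q /(semispray_position sg).
by rewrite -E1 -E2.
Qed.

Lemma has_diff_theta x h dx : has_diff x z h dx ->
  has_diff (fun q => theta q (x q)) z h (dx.1.2 - ((x z).1.1 *: h.2 + dx.1.1 *: z.2)).
Proof.
move=> hx; apply: has_diffB; first exact: has_diff_snd (has_diff_fst hx).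
apply: (has_diffZ (k := fun q => (x q).1.1 : R^o)).
  exact: has_diff_fst (has_diff_fst hx).
exact: has_diff_snd (has_diff_id _ _).
Qed.

Lemma has_diff_vert (w : E -> rV) h dw : has_diff w z h dw ->
  has_diff (fun q => vert (w q)) z h (vert dw).
Proof.
by move=> hw; apply: has_diff_pair hw; exact: has_diff_cst.
Qed.

Lemma has_diff_nonlin (w : E -> rV) h dw : has_diff w z h dw ->
  has_diff (fun q => nonlin g q (w q)) z h (nonlin g z dw + dnonlin g z (w z) h).
Proof.
move=> hw; have H := has_diff_snd (has_diff_diff_apply (has_coords_ecoord R n) oA Az
  (semispray_smooth sg 2%N) (has_diff_vert hw)).
apply: has_diff_eq (has_diffZ (has_diff_cst (- 2^-1 : R^o) z h) H).
by rewrite scale0r addr0 /= scalerDr addrC.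
Qed.

Lemma has_diff_psi x h dx dx2 : has_diff x z h dx ->
  has_diff (fun q => theta q (x q)) z h dx2 ->
  has_diff (fun q => psi g q (x q)) z h
    (dx.2 - ((x z).1.1 *: ('d g z h).2 + dx.1.1 *: (g z).2) +
     (nonlin g z dx2 + dnonlin g z (theta z (x z)) h)).
Proof.
move=> hx hx2; apply: has_diffD; last exact: (has_diff_nonlin hx2).
apply: has_diffB; first exact: has_diff_snd hx.
apply: (has_diffZ (k := fun q => (x q).1.1 : R^o)).
  exact: has_diff_fst (has_diff_fst hx).
exact: has_diff_snd (has_diff_diff h semispray_differentiable).
Qed.

Lemma has_diff_hor (w : E -> rV) h dw : has_diff w z h dw ->
  has_diff (fun q => hor g q (w q)) z h (0, dw, - (nonlin g z dw + dnonlin g z (w z) h)).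
Proof.
move=> hw; apply: has_diff_pair; last exact/has_diffN/has_diff_nonlin.
by apply: has_diff_pair hw; exact: has_diff_cst.
Qed.

(* The tensor [P_V - P_H] is the Lie derivative of [S] along the second-order
   field; this makes the projectors independent of the chart. *)
Lemma lie_local_S x : differentiable x z ->
  lie g (fun q => local_S q (x q)) z - local_S z (lie g x z) = local_V g z (x z) - local_H g z
    (x z).
Proof.
move=> dx; have [_ E1] := has_diff_vert (has_diff_theta (has_diff_diff (g z) dx)).
(* Of the differential of [g] only these components matter: the first ones come from the position
   part $(1,u)$ of [g], the last from the definition of [nonlin]. With them abstracted, the identity
   is polynomial in the entries. *)
suff alg (dxg gx gv : E) : gx.1 = (0, (x z).2) -> gv.1 = (0, theta z (x z)) ->
    gv.2 = - (nonlin g z (theta z (x z)) *+ 2) ->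
    vert (dxg.1.2 - ((x z).1.1 *: (g z).2 + dxg.1.1 *: z.2)) - gv - local_S z (dxg - gx) =
    local_V g z (x z) - local_H g z (x z).
  apply: etrans (congr1 (fun t => t - 'd g z (local_S z (x z)) - local_S z ('d x z (g z) - 'd g
    z (x z))) E1) _.
  by apply: alg; [exact: diff_semispray|exact: diff_semispray|exact: diff_vert].
case: gx gv => _ gx [_ gv] /= -> -> ->; rewrite /local_V /local_H /hor /psi.
move: (nonlin g z _) => N; case: dxg => [[dt dq] du]; rewrite /local_S /vert /theta /=.
case: (x z) => [[t q] u] /=; congr (_, _, _) => /=.
- by ring.
- by apply/rowP => i; rewrite !mxE; ring.
by apply/rowP => i; rewrite !mxE; ring.
Qed.

Lemma lie_has_diff x y a b : has_diff y z (x z) a -> has_diff x z (y z) b ->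
  lie x y z = a - b.
Proof. by move=> [_ <-] [_ <-]. Qed.

(** * The brackets of the explicit formula, evaluated at a point *)

Section Covariant.
Variables x y : E -> E.
Hypotheses (dx : differentiable x z) (dy : differentiable y z).

Let x0 := (x z).1.1.
Let x2 := theta z (x z).
Let y1 := psi g z (y z).
Let y2 := theta z (y z).

Definition diff_time h : R := 'd (fun q => (y q).1.1 : R^o) z h.
Definition diff_psi h : rV := 'd (fun q => psi g q (y q)) z h.
Definition diff_theta h : rV := 'd (fun q => theta q (y q)) z h.

Let hd_theta h : has_diff (fun q => theta q (y q)) z h (diff_theta h).
Proof. by apply: has_diff_diff; case: (has_diff_theta (has_diff_diff h dy)). Qed.

Let hd_psi h : has_diff (fun q => psi g q (y q)) z h (diff_psi h).
Proof.
by apply: has_diff_diff; case: (has_diff_psi (has_diff_diff h dy) (hd_theta h)).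
Qed.

(** The bracket also has a [theta] part [- d]; its contribution to [psi] cancels the [nonlin] term
    of the differentiated horizontal lift. What remains besides the derivative of [theta] is the
    derivative of the coefficients along [vert y2], that is $\hat\nabla_{H_i}H_j$. *)
Lemma lie_local_H_local_S :
  local_Q g z (lie (fun q => local_H g q (x q)) (fun q => local_S q (y q)) z) =
  hor g z (diff_theta (local_H g z (x z)) + dnonlin g z x2 (vert y2)).
Proof.
have [d E1] := has_diff_theta (has_diff_diff (local_S z (y z)) dx).
have H := has_diff_hor (has_diff_diff (local_S z (y z)) d).
rewrite (lie_has_diff (x := fun q => local_H g q (x q)) (has_diff_vert (hd_theta _)) H) /local_Q.
congr (hor g z _); rewrite /psi /theta /= !subr0 !scale0r !subr0 sub0r nonlinN.
move: (nonlin _ _ _) (dnonlin _ _ _ _) (diff_theta _) => N D T.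
by apply/rowP => i; rewrite !mxE; ring.
Qed.

(** All coefficient terms of the differentiated horizontal lift sit in the [u] component, which $S$
    does not see; this matches the vanishing of $\hat\nabla_{V_i}V_j$. *)
Lemma lie_local_V_local_Q :
  local_S z (lie (fun q => local_V g q (x q)) (fun q => local_Q g q (y q)) z) =
  vert (diff_psi (local_V g z (x z))).
Proof.
have [d1 _] := has_diff_theta (has_diff_diff (local_Q g z (y z)) dx).
have [d2 _] := has_diff_psi (has_diff_diff (local_Q g z (y z)) dx) (has_diff_diff _ d1).
rewrite (lie_has_diff (x := fun q => local_V g q (x q)) (y := fun q => local_Q g q (y q))
  (has_diff_hor (hd_psi _)) (has_diff_vert (has_diff_diff _ d2))).
by congr (vert _); rewrite /theta /= !subr0 scale0r subr0.
Qed.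

(** The extra term is $\hat\nabla_\Gamma H_i$. It arises because $\theta^i = dx^i - u^i dt$ is
    differentiated along [hor g z y2], whose [u] component is [- nonlin g z y2]; the derivatives of
    [x] cancel. *)
Lemma lie_sub_local_H :
  local_H g z (lie (fun q => x q - local_H g q (x q)) (fun q => local_H g q (y q)) z) =
  hor g z (diff_theta (x z - local_H g z (x z)) + x0 *: nonlin g z y2).
Proof.
have hx := has_diff_diff (local_H g z (y z)) dx.
rewrite (lie_has_diff (x := fun q => x q - local_H g q (x q)) (y := fun q => local_H g q (y q))
  (has_diff_hor (hd_theta _)) (has_diffB hx (has_diff_hor (has_diff_theta hx)))).
congr (hor g z _); rewrite /theta /=; case: ('d x z _) => [[t p] u] /=.
apply/rowP => i; rewrite !mxE; rewrite -[x0]/((x z).1.1); move: (diff_theta _ 0 i) => D.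
by rewrite ?mxE; ring.
Qed.

(** Differentiating the force along [vert y1] yields twice [nonlin g z y1], and the [theta] part
    [- x0 *: y1] of the bracket takes one copy back through [psi]. The remaining copy is
    $\hat\nabla_\Gamma V_i$; the [dnonlin] term is $\hat\nabla_{H_i}V_j$. *)
Lemma lie_sub_local_V :
  local_V g z (lie (fun q => x q - local_V g q (x q)) (fun q => local_V g q (y q)) z) =
  vert (diff_psi (x z - local_V g z (x z)) + x0 *: nonlin g z y1 + dnonlin g z x2 (vert y1)).
Proof.
have hx := has_diff_diff (local_V g z (y z)) dx.
rewrite (lie_has_diff (x := fun q => x q - local_V g q (x q)) (y := fun q => local_V g q (y q))
  (has_diff_vert (hd_psi _)) (has_diffB hx (has_diff_vert (has_diff_psi hx (has_diff_theta hx))))).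
have dg := diff_vert g z y1.
suff alg (dgv xd : E) : dgv.2 = - (nonlin g z y1 *+ 2) ->
    let d2 := xd.1.2 - (x0 *: y1 + xd.1.1 *: z.2) in
    psi g z (vert (diff_psi (x z - local_V g z (x z))) - (xd -
      vert (xd.2 - (x0 *: dgv.2 + xd.1.1 *: (g z).2) + (nonlin g z d2 + dnonlin g z x2 (vert
        y1))))) =
    diff_psi (x z - local_V g z (x z)) + x0 *: nonlin g z y1 + dnonlin g z x2 (vert y1).
  by congr (vert _); exact: alg.
move: (dnonlin _ _ _ _) (diff_psi _) x0 => DN D c -> d2.
have -> : vert D - (xd - vert (xd.2 - (c *: - (nonlin g z y1 *+ 2) + xd.1.1 *: (g z).2) +
    (nonlin g z d2 + DN))) = (- xd.1.1, - xd.1.2, D + c *: (nonlin g z y1 *+ 2) - xd.1.1 *: (g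
      z).2 +
    (nonlin g z d2 + DN)) :> E.
  case: xd @d2 => [[t p] u] d2; congr (_, _, _) => /=; rewrite ?subr0 ?sub0r //.
  move: (nonlin g z d2) (nonlin g z y1) => N1 N2.
  by apply/rowP => i; rewrite !mxE; ring.
rewrite /psi; have -> : theta z (- xd.1.1, - xd.1.2, D + c *: (nonlin g z y1 *+ 2) - xd.1.1 *:
  (g z).2 +
    (nonlin g z d2 + DN)) = - d2 - c *: y1.
  by rewrite /theta /= /d2; apply/rowP => i; rewrite !mxE; ring.
rewrite (nonlinD g z (- d2)) (nonlinN g z d2) (nonlinN g z (c *: y1)) nonlinZ /=; move: (nonlin
  g z d2) (nonlin g z y1) => N1 N2.
by apply/rowP => i; rewrite !mxE; ring.
Qed.

(** Differentials of [g] have no time component because that of [g] is constantly 1; for the same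
    reason [x - local_G g z x] has identically vanishing time component and contributes no
    derivative. *)
Lemma time_lie_sub_local_G :
  (lie (fun q => x q - local_G g q (x q)) (fun q => local_G g q (y q)) z).1.1 =
  diff_time (x z - local_G g z (x z)).
Proof.
have hG (w : E -> E) h : differentiable w z -> has_diff (fun q => local_G g q (w q)) z h
    ((w z).1.1 *: 'd g z h + ('d w z h).1.1 *: g z).
  move=> dw; apply: (has_diffZ (k := fun q => (w q).1.1 : R^o)).
    exact: has_diff_fst (has_diff_fst (has_diff_diff h dw)).
  exact: has_diff_diff semispray_differentiable.
have dt h : diff_time h = ('d y z h).1.1.
  by have [_ <-] := has_diff_fst (has_diff_fst (has_diff_diff h dy)).
rewrite (lie_has_diff (x := fun q => x q - local_G g q (x q)) (y := fun q => local_G g q (y q))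
  (hG _ _ dy) (has_diffB (has_diff_diff _ dx) (hG _ _ dx))) dt.
have g1 := time_semispray Az.
suff alg (dgk dgh xd yd : E) (c c' : R) : dgk.1 = (0, dgk.1.2) -> dgh.1 = (0, dgh.1.2) ->
    (c *: dgk + yd.1.1 *: g z - (xd - (c' *: dgh + xd.1.1 *: g z))).1.1 = yd.1.1.
  by apply: alg; rewrite diff_semispray.
move=> k0 h0 /=; rewrite g1 k0 h0 /= scaler0 [c' *: _]scaler0 !add0r.
by rewrite -![_ *: (1 : R)]/(_ * 1) !mulr1 subrr subr0.
Qed.

(* The Massa-Pagani connection in the adapted frame: the derivatives of the
   components of [y] along [x], plus the values of the connection on the frame. *)
Definition connection_value : E :=
  diff_time (x z) *: g z + vert (diff_psi (x z)) + hor g z (diff_theta (x z)) +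
  x0 *: (vert (nonlin g z y1) + hor g z (nonlin g z y2)) +
  (vert (dnonlin g z x2 (vert y1)) + hor g z (dnonlin g z x2 (vert y2))).

Lemma connection_valueE :
  diff_time (x z) *: g z +
  local_Q g z (lie (fun q => local_H g q (x q)) (fun q => local_S q (y q)) z) +
  local_S z (lie (fun q => local_V g q (x q)) (fun q => local_Q g q (y q)) z) +
  local_H g z (lie (fun q => x q - local_H g q (x q)) (fun q => local_H g q (y q)) z) +
  local_V g z (lie (fun q => x q - local_V g q (x q)) (fun q => local_V g q (y q)) z) =
    connection_value.
Proof.
rewrite lie_local_H_local_S lie_local_V_local_Q lie_sub_local_H lie_sub_local_V.
have horD w w' : hor g z (w + w') = hor g z w + hor g z w'.
  by rewrite -[w]scale1r hor_linear !scale1r.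
have vertD w w' : vert (w + w') = vert w + vert w' :> E.
  by rewrite -[w]scale1r vert_linear !scale1r.
have horZ c w : hor g z (c *: w) = c *: hor g z w.
  have h0 : hor g z 0 = 0 by rewrite /hor nonlin0 oppr0.
  by rewrite -[c *: w]addr0 hor_linear h0 addr0.
have vertZ c w : vert (c *: w) = c *: vert w :> E.
  have v0 : vert 0 = 0 :> E by [].
  by rewrite -[c *: w]addr0 vert_linear v0 addr0.
have -> : diff_theta (x z - local_H g z (x z)) = diff_theta (x z) - diff_theta (local_H g z (x z)).
  by rewrite /diff_theta linearB.
have -> : diff_psi (x z - local_V g z (x z)) = diff_psi (x z) - diff_psi (local_V g z (x z)).
  by rewrite /diff_psi linearB.
rewrite /connection_value.
move: (dnonlin g z x2 (vert y2)) (dnonlin g z x2 (vert y1)) => p' q'.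
move: (nonlin g z y1) (nonlin g z y2) x0 => s' r' k.
move: (diff_theta (x z)) (diff_theta (local_H _ _ _)) (diff_psi (x z)) (diff_psi (local_V _ _
  _)) => a' b' c' d'.
rewrite !horD !vertD !horZ !vertZ scalerDr.
have horN w : hor g z (- w) = - hor g z w by rewrite -scaleN1r horZ scaleN1r.
have vertN w : vert (- w) = - vert w :> E by rewrite -scaleN1r vertZ scaleN1r.
rewrite horN vertN.
move: (hor g z a') (hor g z b') (vert c') (vert d') => a b c d.
move: (hor g z p') (vert q') (_ *: hor g z r') (_ *: vert s') (_ *: g z) => p q r s t.
(* The derivative along [x] is split into those along the projection of [x] and along the remainder,
   as the brackets produce them; both sides are then the same sum up to order. *)
rewrite -{2}(subrK b a) -{2}(subrK d c).
by rewrite (AC (1*2*1*2*3) (1*(7*4)*(5*2)*(8*6)*(9*3)))%AC.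
Qed.

End Covariant.
End AtPoint.
End Semispray.

(** * Tensor fields, and covariant derivatives built from brackets *)

Section AtlasTensors.
Variables (R : realType) (T : Type) (V : normedModType R) (A : charting T V).
Hypothesis hA : smooth_atlas A.
Implicit Types (a b c : idx A) (e : T) (W : set T) (X Y : vfield A) (L : idx A -> T -> V -> V).

Lemma lie_near (x x' y y' : V -> V) z : (\near z, x z = x' z) -> (\near z, y z = y' z) ->
  differentiable x z -> differentiable y z -> lie x y z = lie x' y' z.
Proof.
move=> ex ey dx dy; have [_ Ex] := near_eq_differentiable ex dx.
have [_ Ey] := near_eq_differentiable ey dy.
rewrite /lie (nbhs_singleton ex) (nbhs_singleton ey).
exact: (congr2 (fun k l : V -> V => k (x' z) - l (y' z)) (esym Ey) (esym Ex)).
Qed.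

Lemma bracket_lie W X Y (x y : V -> V) a e : chart_open A W -> W e -> dom a e ->
  smooth_on W X -> smooth_on W Y ->
  (forall e, W e -> dom a e -> X a e = x (coord a e)) ->
  (forall e, W e -> dom a e -> Y a e = y (coord a e)) ->
  bracket X Y a e = lie x y (coord a e).
Proof.
move=> oW We ae sX sY Ex Ey; rewrite (bracketE hA) //.
apply: lie_near (smooth_on_differentiable sX We ae) (smooth_on_differentiable sY We ae).
  by apply: (near_img oW We ae) => e' We' ae'; rewrite (local_rep_coord hA) // Ex.
by apply: (near_img oW We ae) => e' We' ae'; rewrite (local_rep_coord hA) // Ey.
Qed.

Definition apply_tensor L X : vfield A := fun a e => L a e (X a e).

Lemma tensor_fieldD L a e v w : tensor_field L -> L a e (v + w) = L a e v + L a e w.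
Proof. by move=> tL; rewrite -[v]scale1r (tensor_linear tL) !scale1r. Qed.

Lemma tensor_field0 L a e : tensor_field L -> L a e 0 = 0.
Proof. by move=> tL; apply: (addrI (L a e 0)); rewrite -tensor_fieldD // !addr0. Qed.

Lemma tensor_fieldZ L a e k v : tensor_field L -> L a e (k *: v) = k *: L a e v.
Proof.
by move=> tL; rewrite -[k *: v]addr0 (tensor_linear tL) tensor_field0 // addr0.
Qed.

Lemma tensor_fieldB L a e v w : tensor_field L -> L a e (v - w) = L a e v - L a e w.
Proof. by move=> tL; rewrite -scaleN1r tensor_fieldD // tensor_fieldZ // scaleN1r. Qed.

(** Serves both $(L_1,L_2,L) = (Q,S,P_H)$ and $(S,Q,P_V)$. $LL_1 = L_1$ puts the values in the
    submodule, $L_1L_2 = L$ gives the Leibniz rule in the second argument, and the vanishing of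
    $L_1$ on the submodule removes the derivative of [f] when the first argument is rescaled. *)
Lemma scd_bracket L1 L2 L (P : vfield A -> vfield A) nabla :
  tensor_field L1 -> tensor_field L2 ->
  (forall a e v, dom a e -> L a e (L1 a e v) = L1 a e v) ->
  (forall a e v, dom a e -> L1 a e (L2 a e v) = L a e v) ->
  (forall a e v, dom a e -> L a e v = v -> L1 a e v = 0) ->
  (forall X a e, dom a e -> P X a e = L a e (X a e)) ->
  (forall W X Y a e, chart_open A W -> smooth_on W X -> smooth_on W Y ->
    W e -> dom a e -> nabla X Y a e = L1 a e (bracket X (apply_tensor L2 Y) a e)) ->
  submodule_covariant_derivative P nabla.
Proof.
move=> t1 t2 LL1 L12 L0 PE nE.
have s2 W Y : chart_open A W -> vector_field W Y -> smooth_on W (apply_tensor L2 Y).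
  by move=> oW vY; apply: (tensor_smooth t2) => //; case: vY.
have imE W X a e : im_on P W X -> W e -> dom a e -> L a e (X a e) = X a e.
  by move=> [_ PX] We ae; rewrite -PE // PX.
split.
- move=> W X Y oW [vX PX] [vY PY].
  have vN : vector_field W (nabla X Y).
    apply: (@vector_field_eq _ _ _ _ hA _ (apply_tensor L1 (bracket X (apply_tensor L2 Y)))) => //.
      by move=> a e We ae; rewrite (nE W) //; [case: vX|case: vY].
    apply: vector_field_tensor => //; apply: vector_field_bracket => //.
    exact: vector_field_tensor.
  split=> // a e We ae; rewrite PE // (nE W) ?LL1 //; [by case: vX|by case: vY].
- move=> W X X' Y Y' oW [vX PX] [vX' PX'] [vY PY] [vY' PY'] EX EY a e We ae.
  rewrite !(nE W) //; try by [case: vX|case: vX'|case: vY|case: vY'].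
  congr (L1 a e _); apply: (bracket_eq hA oW) => //; [by case: vX|exact: s2|].
  by move=> b e' We' be; rewrite /apply_tensor EY.
- move=> W X X' Y oW [vX PX] [vX' PX'] [vY PY] a e We ae.
  have [_ sA] := vector_field_add hA oW vX vX'.
  rewrite /vf_add !(nE W) //; try by [case: vX|case: vX'|case: vY].
  rewrite -tensor_fieldD //; congr (L1 a e _).
  rewrite !(bracketC (apply_tensor L2 Y)) -opprD; congr (- _).
  by apply: (bracket_addr hA _ oW) => //; [case: vX|case: vX'].
- move=> W f X Y oW sf iX [vY PY] a e We ae; have [vX PX] := iX.
  have [_ sA] := vector_field_scale hA oW (scalar_field_fun sf) vX.
  rewrite [RHS]/vf_scale !(nE W) //; try by [case: vX|case: vY].
  rewrite -tensor_fieldZ // bracketC (bracket_scaler hA _ oW) //; last by case: vX.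
  rewrite opprD -scalerN -bracketC tensor_fieldB // [X in _ - X]tensor_fieldZ //.
  by rewrite (L0 _ _ (X a e)) ?scaler0 ?subr0 // (imE W).
- move=> W X Y Y' oW [vX PX] [vY PY] [vY' PY'] a e We ae.
  have [_ sA] := vector_field_add hA oW vY vY'.
  rewrite /vf_add !(nE W) //; try by [case: vX|case: vY'|case: vY].
  rewrite -tensor_fieldD //; congr (L1 a e _).
  rewrite -(bracket_addr hA _ oW) //; try exact: s2.
  congr (bracket X _ a e); apply/funext => b; apply/funext => e'.
  by rewrite /vf_add /apply_tensor tensor_fieldD.
move=> W f X Y oW sf [vX PX] iY a e We ae; have [vY PY] := iY.
have [_ sA] := vector_field_scale hA oW (scalar_field_fun sf) vY.
rewrite [RHS]addrC /vf_add /vf_scale !(nE W) //; try by [case: vX|case: vY].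
have -> : apply_tensor L2 (fun a e => f e *: Y a e) = vf_scale (fun=> f) (apply_tensor L2 Y).
  apply/funext => b; apply/funext => e'.
  by rewrite /vf_scale /apply_tensor tensor_fieldZ.
rewrite (bracket_scaler hA _ oW) //; last exact: s2.
rewrite tensor_fieldD // !tensor_fieldZ //; congr (_ + _ *: _).
by rewrite /apply_tensor L12 // (imE W).
Qed.

End AtlasTensors.

(** * The submodule covariant derivatives *)

Section AdaptedTensors.
Variables (R : realType) (n : nat) (M : smooth_manifold R n).
Local Notation E := (evolution_space M).
Local Notation V := (ecoord R n).
Local Notation C := (idx (adapted M)).
Local Notation hE := (adapted_atlas M).
Variable G : vfield (adapted M).
Hypothesis hG : second_order_field G.
Implicit Types (a b : C) (e : E) (W : set E) (X Y : vfield (adapted M)).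

Definition gloc a : V -> V := local_rep a (G a).
Definition S_at a e : V -> V := local_S (coord a e).
Definition Q_at a e : V -> V := local_Q (gloc a) (coord a e).
Definition G_at a e : V -> V := local_G (gloc a) (coord a e).
Definition V_at a e : V -> V := local_V (gloc a) (coord a e).
Definition H_at a e : V -> V := local_H (gloc a) (coord a e).

Lemma gloc_coord a e : dom a e -> gloc a (coord a e) = G a e.
Proof. exact: (local_rep_coord hE). Qed.

Lemma semispray_gloc W a : chart_open (adapted M) W ->
  semispray (coord a @` (W `&` dom a)) (gloc a).
Proof.
move=> oW; have [[tG sG] G1] := hG; split; first exact: oW.
  by apply: (smooth_on_subset _ sG) => //.
by move=> z [e [We ae] <-]; rewrite gloc_coord // G1.
Qed.

Lemma sum_unit_vec (U : lmodType R) (L : 'rV[R]_n -> U) (w : 'rV[R]_n) : linear L ->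
  \sum_i w 0 i *: L (unit_vec R i) = L w.
Proof.
move=> lL; pose LL : {linear 'rV[R]_n -> U} := HB.pack L (GRing.isLinear.Build _ _ _ _ _ lL).
rewrite [in RHS](row_sum_delta w) -[RHS]/(LL _) linear_sum; apply: eq_bigr => i _.
by rewrite linearZ.
Qed.

Lemma conn_coefE a i j e : dom a e ->
  conn_coef G a i j e = nonlin (gloc a) (coord a e) (unit_vec R j) 0 i.
Proof.
move=> ae; have sg := semispray_gloc a (chart_openT hE).
have Az : (coord a @` (setT `&` dom a)) (coord a e) by exists e.
have hd := has_diff_entry i (has_diff_snd (has_diff_diff (vert (unit_vec R j))
  (semispray_differentiable sg Az))).
have [|d E1] := has_diff_near (g := local_rep (Z := R^o) a (force G a i)) _ hd.
  apply: (near_img (chart_openT hE) I ae) => e' _ ae'.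
  by rewrite /force (local_rep_coord hE) // gloc_coord.
by rewrite /conn_coef /partial_u /nonlin deriveE // E1 mxE.
Qed.

Lemma frame_HE a i e : dom a e -> frame_H G a i e = hor (gloc a) (coord a e) (unit_vec R i).
Proof.
move=> ae; congr (_, _, - _).
rewrite [RHS]row_sum_delta; apply: eq_bigr => j _.
by rewrite conn_coefE.
Qed.

Lemma form_thetaE a i e v : form_theta a i e v = theta (coord a e) v 0 i.
Proof. by rewrite /theta !mxE /form_theta mulrC. Qed.

Lemma nonlin_sum a i e (w : 'rV[R]_n) : dom a e ->
  \sum_j conn_coef G a i j e * w 0 j = nonlin (gloc a) (coord a e) w 0 i.
Proof.
move=> ae; rewrite -(sum_unit_vec w (nonlin_linear _ _)) summxE; apply: eq_bigr => j _.
by rewrite conn_coefE // [RHS]mxE mulrC.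
Qed.

Lemma form_psiE a i e v : dom a e ->
  form_psi G a i e v = psi (gloc a) (coord a e) v 0 i.
Proof.
move=> ae; rewrite /form_psi.
have -> : \sum_j conn_coef G a i j e * form_theta a j e v =
    nonlin (gloc a) (coord a e) (theta (coord a e) v) 0 i.
  by rewrite -nonlin_sum //; apply: eq_bigr => j _; rewrite form_thetaE.
by rewrite /psi gloc_coord //; move: (nonlin _ _ _) => N; rewrite !mxE [force _ _ _ _ * _]mulrC.
Qed.

Lemma tensor_SE X : tensor_S X = apply_tensor S_at X.
Proof.
apply/funext => a; apply/funext => e; rewrite /tensor_S /apply_tensor /S_at /local_S.
rewrite -(sum_unit_vec _ (@vert_linear R n)); apply: eq_bigr => i _.
by rewrite form_thetaE.
Qed.

Lemma tensor_QE X a e : dom a e -> tensor_Q G X a e = Q_at a e (X a e).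
Proof.
move=> ae; rewrite /tensor_Q /Q_at /local_Q -(sum_unit_vec _ (hor_linear _ _)).
by apply: eq_bigr => i _; rewrite form_psiE // frame_HE.
Qed.

Lemma proj_GE X a e : dom a e -> proj_G G X a e = G_at a e (X a e).
Proof. by move=> ae; rewrite /proj_G /G_at /local_G gloc_coord. Qed.

Lemma proj_VE X a e : dom a e -> proj_V G X a e = V_at a e (X a e).
Proof.
move=> ae; rewrite /proj_V /V_at /local_V -(sum_unit_vec _ (@vert_linear R n)).
by apply: eq_bigr => i _; rewrite form_psiE.
Qed.

Lemma proj_HE X a e : dom a e -> proj_H G X a e = H_at a e (X a e).
Proof.
move=> ae; rewrite /proj_H /H_at /local_H -(sum_unit_vec _ (hor_linear _ _)).
by apply: eq_bigr => i _; rewrite form_thetaE frame_HE.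
Qed.

Local Notation mtransition := (@transition _ _ _ (mcharts M)).

Lemma jac_time a b e v : dom a e -> dom b e -> (jac a b e v).1.1 = v.1.1.
Proof. by move=> ae be; rewrite adapted_jac. Qed.

Lemma jac_vert a b e w : dom a e -> dom b e ->
  jac a b e (vert w) = vert ('d (mtransition a b) ((coord a e).1.2) w).
Proof. by move=> ae be; rewrite adapted_jac //= derive0 linear0 add0r. Qed.

Lemma theta_jac a b e v : dom a e -> dom b e ->
  theta (coord b e) (jac a b e v) = 'd (mtransition a b) ((coord a e).1.2) (theta (coord a e) v).
Proof.
move=> ae be; rewrite adapted_jac // /theta [RHS]linearB [X in _ = _ - X]linearZ /=.
by congr (_ - _ *: _); exact: (comp_compat ae be).
Qed.

Lemma tensor_S_at : tensor_field S_at.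
Proof.
split; first by move=> a e; exact: local_S_linear.
  by move=> a b e v ae be; rewrite /S_at /local_S theta_jac // jac_vert.
move=> W X oW sX.
apply: (smooth_onP hE oW (fun a k => Ck_vert (semispray_gloc a oW) (Ck_theta (semispray_gloc a
  oW) (sX a k)))).
by move=> a e We ae; rewrite (local_rep_coord hE).
Qed.

(** The vector [v] is extended to the field with constant components in chart [a]. Then [B] is
    $(\mathcal L_\Gamma S)(X)$, a field because brackets and $S$ are natural, and [lie_local_S]
    evaluates it in both charts. *)
Lemma V_at_H_at_natural a b e v : dom a e -> dom b e ->
  V_at b e (jac a b e v) - H_at b e (jac a b e v) = jac a b e (V_at a e v - H_at a e v).
Proof.
move=> ae be; pose W := @dom _ _ _ (adapted M) a.
have oW : chart_open (adapted M) W by exact: (atlas_open hE).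
pose X := field_of_chart a (fun=> v).
have vX : vector_field W X by apply: (vector_field_of_chart hE) => // k; exact: Ck_cst.
have vG : vector_field W G by apply: vector_field_subset hG.1.
have vSX : vector_field W (apply_tensor S_at X) by exact: (vector_field_tensor tensor_S_at).
pose B := vf_sub (bracket G (apply_tensor S_at X)) (apply_tensor S_at (bracket G X)).
have vB : vector_field W B.
  apply: (vector_field_sub hE) => //; first exact: (vector_field_bracket hE).
  apply: (vector_field_tensor tensor_S_at) => //; exact: (vector_field_bracket hE).
have BE c : dom c e -> B c e = V_at c e (X c e) - H_at c e (X c e).
  move=> ce; have sg := semispray_gloc c oW.
  have We : W e by [].
  have dX := smooth_on_differentiable vX.2 We ce.
  have Az : (coord c @` (W `&` dom c)) (coord c e) by exists e.
  have E1 : bracket G (apply_tensor S_at X) c e =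
      lie (gloc c) (fun q => local_S q (local_rep c (X c) q)) (coord c e).
    apply: (bracket_lie hE oW) => //; [exact: vG.2|exact: vSX.2| |].
      by move=> e' _ ce'; rewrite gloc_coord.
    by move=> e' We' ce'; rewrite /apply_tensor (local_rep_coord hE).
  have E2 : bracket G X c e = lie (gloc c) (local_rep c (X c)) (coord c e).
    exact: (bracketE hE).
  apply: etrans (congr2 (fun u v => u - local_S (coord c e) v) E1 E2) _.
  apply: etrans (lie_local_S sg Az dX) _.
  exact: (congr1 (fun u => V_at c e u - H_at c e u) (@local_rep_coord _ _ _ _ hE _ c (X c) e ce)).
have Xa : X a e = v by exact: (field_of_chartE hE).
apply: etrans (esym (BE b be)) _; apply: etrans (vB.1 e ae a b ae be) _.
apply: (congr1 (jac a b e)); apply: etrans (BE a ae) _.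
exact: (congr1 (fun u => V_at a e u - H_at a e u) Xa).
Qed.

Lemma G_at_natural a b e v : dom a e -> dom b e -> G_at b e (jac a b e v) = jac a b e (G_at a e v).
Proof.
move=> ae be; rewrite /G_at /local_G !gloc_coord // jac_time // linearZ; congr (_ *: _).
exact: hG.1.1.
Qed.

Lemma decomposition a e v : dom a e -> v = G_at a e v + V_at a e v + H_at a e v.
Proof.
move=> ae; apply: (semispray_decomp (semispray_gloc a (chart_openT hE))).
by exists e.
Qed.

Lemma V_at_H_at_naturalD a b e v : dom a e -> dom b e ->
  V_at b e (jac a b e v) + H_at b e (jac a b e v) = jac a b e (V_at a e v) + jac a b e (H_at a e v).
Proof.
move=> ae be; apply: (addrI (G_at b e (jac a b e v))).
rewrite addrA -decomposition // G_at_natural // addrA -!linearD; congr (jac a b e _).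
exact: decomposition.
Qed.

Lemma V_at_natural a b e v : dom a e -> dom b e -> V_at b e (jac a b e v) = jac a b e (V_at a e v).
Proof.
move=> ae be; have E1 := V_at_H_at_natural v ae be; have E2 := V_at_H_at_naturalD v ae be.
have two (x y : V) : 2%:R *: x = (x + y) + (x - y).
  by rewrite addrACA subrr addr0 scaler_nat mulr2n.
have n2 : (2%:R : R) != 0 by rewrite pnatr_eq0.
by apply: (scalerI n2); rewrite (two _ (H_at b e (jac a b e v))) (two _ (jac a b e (H_at a e
  v))) E1 E2 linearB.
Qed.

Lemma H_at_natural a b e v : dom a e -> dom b e -> H_at b e (jac a b e v) = jac a b e (H_at a e v).
Proof.
move=> ae be; apply: (addrI (V_at b e (jac a b e v))).
by rewrite V_at_H_at_naturalD // V_at_natural.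
Qed.

(** Naturality of $P_V$ says that [psi] transforms by [phi]; naturality of $P_H$ on horizontal
    vectors says that [hor] does. $Q$ is their composite. *)
Lemma Q_at_natural a b e v : dom a e -> dom b e -> Q_at b e (jac a b e v) = jac a b e (Q_at a e v).
Proof.
move=> ae be; set phi := 'd (mtransition a b) ((coord a e).1.2).
have psE : psi (gloc b) (coord b e) (jac a b e v) = phi (psi (gloc a) (coord a e) v).
  have := V_at_natural v ae be; rewrite /V_at /local_V jac_vert // => E0.
  exact: (congr1 snd E0).
have horE w : hor (gloc b) (coord b e) (phi w) = jac a b e (hor (gloc a) (coord a e) w).
  have := H_at_natural (hor (gloc a) (coord a e) w) ae be.
  by rewrite /H_at /local_H theta_jac // theta_hor.
by rewrite /Q_at /local_Q psE horE.
Qed.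

Lemma tensor_G_at : tensor_field G_at.
Proof.
split; [by move=> a e; exact: local_G_linear|exact: G_at_natural|].
move=> W X oW sX.
apply: (smooth_onP hE oW (fun a k => Ck_local_G (semispray_gloc a oW) (sX a k))).
by move=> a e We ae; rewrite (local_rep_coord hE).
Qed.

Lemma tensor_V_at : tensor_field V_at.
Proof.
split; [by move=> a e; exact: local_V_linear|exact: V_at_natural|].
move=> W X oW sX.
apply: (smooth_onP hE oW (fun a k => Ck_vert (semispray_gloc a oW) (Ck_psi (semispray_gloc a oW)
  (sX a k)))).
by move=> a e We ae; rewrite (local_rep_coord hE).
Qed.

Lemma tensor_H_at : tensor_field H_at.
Proof.
split; [by move=> a e; exact: local_H_linear|exact: H_at_natural|].
move=> W X oW sX.
apply: (smooth_onP hE oW (fun a k => Ck_hor (semispray_gloc a oW) (Ck_theta (semispray_gloc a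
  oW) (sX a k)))).
by move=> a e We ae; rewrite (local_rep_coord hE).
Qed.

Lemma tensor_Q_at : tensor_field Q_at.
Proof.
split; [by move=> a e; exact: local_Q_linear|exact: Q_at_natural|].
move=> W X oW sX.
apply: (smooth_onP hE oW (fun a k => Ck_hor (semispray_gloc a oW) (Ck_psi (semispray_gloc a oW)
  (sX a k)))).
by move=> a e We ae; rewrite (local_rep_coord hE).
Qed.

Lemma nabla_HE X Y a e : dom a e ->
  nabla_H G X Y a e = Q_at a e (bracket X (apply_tensor S_at Y) a e).
Proof. by move=> ae; rewrite /nabla_H tensor_SE; exact: tensor_QE. Qed.

(** Unlike [tensor_SE], [tensor_QE] holds only on chart domains; the two brackets are compared by
    locality, which calls for smoothness. *)
Lemma nabla_VE W X Y a e : chart_open (adapted M) W -> smooth_on W X -> smooth_on W Y ->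
  W e -> dom a e -> nabla_V G X Y a e = S_at a e (bracket X (apply_tensor Q_at Y) a e).
Proof.
move=> oW sX sY We ae; rewrite /nabla_V tensor_SE; congr (S_at a e _).
apply/esym; apply: (bracket_eq hE oW) => //; first exact: (tensor_smooth tensor_Q_at).
by move=> b e' We' be; rewrite tensor_QE.
Qed.

Lemma nabla_H_scd : submodule_covariant_derivative (proj_H G) (nabla_H G).
Proof.
apply: (scd_bracket hE tensor_Q_at tensor_S_at) proj_HE _ => [a e v _|a e v _|a e v _ E0|W X Y a
  e _ _ _ _ ae].
- by rewrite /H_at /local_H theta_hor.
- by rewrite /Q_at /local_Q psi_vert.
- by rewrite -E0 /Q_at /local_Q psi_hor /hor nonlin0 oppr0.
exact: nabla_HE.
Qed.

Lemma nabla_V_scd : submodule_covariant_derivative (proj_V G) (nabla_V G).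
Proof.
apply: (scd_bracket hE tensor_S_at tensor_Q_at) proj_VE _ => [a e v _|a e v _|a e v _ E0|W X Y a
  e oW sX sY We ae].
- by rewrite /V_at /local_V psi_vert.
- by rewrite /S_at /local_S theta_hor.
- by rewrite -E0 /S_at /local_S theta_vert.
exact: (nabla_VE oW).
Qed.

Lemma scalar_field_dt W Y : chart_open (adapted M) W -> vector_field W Y -> scalar_field W
  (dt_of Y).
Proof.
move=> oW [tY sY]; split.
  by move=> a b e We ae be; rewrite /dt_of /form_dt (tY e We a b ae be) jac_time.
apply: (smooth_onP hE oW (fun a k => Ck_fst (oW a) (Ck_fst (oW a) (sY a k)))).
by move=> a e We ae; rewrite (local_rep_coord hE).
Qed.

Lemma nabla_G_scd : submodule_covariant_derivative (proj_G G) (nabla_G G).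
Proof.
have vG W : vector_field W G by apply: vector_field_subset hG.1.
have sdt W Y : chart_open (adapted M) W -> vector_field W Y ->
    smooth_on (Z := R^o) W (dt_of Y).
  by move=> oW vY; case: (scalar_field_dt oW vY).
split.
- move=> W X Y oW [vX PX] [vY PY]; split.
    apply: (vector_field_scale hE) => //.
    by apply: (scalar_field_deriv hE) => //; exact: scalar_field_dt.
  move=> a e We ae; rewrite proj_GE // /G_at /local_G gloc_coord // /nabla_G /vf_scale /=.
  by rewrite (hG.2 a e ae) /= [_ *: 1]mulr1.
- move=> W X X' Y Y' oW [vX PX] [vX' PX'] [vY PY] [vY' PY'] EX EY a e We ae.
  rewrite /nabla_G /vf_scale; congr (_ *: _).
  apply: (along_eq hE oW We ae) => //; [exact: EX| |exact: sdt].
  by move=> e' We' ae'; rewrite /dt_of EY.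
- move=> W X X' Y oW [vX PX] [vX' PX'] [vY PY] a e We ae.
  by rewrite /nabla_G /vf_scale /vf_add -scalerDl /deriv_fun /along linearD.
- move=> W f X Y oW sf [vX PX] [vY PY] a e We ae.
  by rewrite /nabla_G /vf_scale scalerA /deriv_fun /along linearZ.
- move=> W X Y Y' oW [vX PX] [vY PY] [vY' PY'] a e We ae.
  rewrite /nabla_G /vf_scale /vf_add -scalerDl; congr (_ *: _).
  exact: (@along_addr _ _ _ _ hE R^o W X (dt_of Y) (dt_of Y') a e oW We ae (sdt _ _ oW vY) (sdt
    _ _ oW vY')).
move=> W f X Y oW sf [vX PX] [vY PY] a e We ae.
rewrite /nabla_G /vf_add /vf_scale.
have := @along_scaler _ _ _ _ hE R^o W X (fun=> f) (dt_of Y) a e oW We ae sf (sdt _ _ oW vY).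
rewrite /deriv_fun => ->; rewrite scalerDl addrC -!scalerA; congr (_ *: _ + _).
(* On the image of $P_\Gamma$ one has $dt(Y)\Gamma = Y$, which turns $X(f)\,dt(Y)\Gamma$ into
   $X(f)Y$. *)
by have := PY a e We ae; rewrite proj_GE // /G_at /local_G gloc_coord.
Qed.

End AdaptedTensors.

(** * The Massa-Pagani connection *)

Section ConnectionCombinations.
Variables (R : realType) (T : Type) (V : normedModType R) (A : charting T V).
Hypothesis hA : smooth_atlas A.
Variable nabla : vfield A -> vfield A -> vfield A.
Hypothesis hN : linear_connection nabla.
Variables (W : set T) (I : Type) (f : I -> T -> R) (F : I -> vfield A).
Hypotheses (oW : chart_open A W) (sf : forall i, smooth_fun_on A W (f i))
  (vF : forall i, vector_field W (F i)).

Definition combination (s : seq I) : vfield A := fun a e => \sum_(i <- s) f i e *: F i a e.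

Let im (X : vfield A) : vector_field W X -> im_on id W X.
Proof. by []. Qed.

Lemma combination_cons i s :
  combination (i :: s) = vf_add (vf_scale (fun=> f i) (F i)) (combination s).
Proof. by apply/funext => a; apply/funext => e; rewrite /combination big_cons. Qed.

Lemma combination_nil : combination [::] = (fun=> fun=> 0).
Proof. by apply/funext => a; apply/funext => e; rewrite /combination big_nil. Qed.

Lemma vector_field_combination s : vector_field W (combination s).
Proof.
elim: s => [|i s IH]; first by rewrite combination_nil; exact: (vector_field_0 hA).
rewrite combination_cons; apply: (vector_field_add hA) => //.
by apply: (vector_field_scale hA) => //; exact: scalar_field_fun.
Qed.

(** Writing the empty combination as zero times zero lets linearity over functions, or the Leibniz
    rule in the second argument, give its derivative. *)
Let zero_scale : (fun=> fun=> 0) = vf_scale (fun=> fun=> 0) (fun=> fun=> 0) :> vfield A.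
Proof. by apply/funext => a; apply/funext => e; rewrite /vf_scale scaler0. Qed.

Let smooth0 : smooth_fun_on A W (fun=> 0).
Proof. exact: (@smooth_onP _ _ _ _ hA R^o W _ (fun=> fun=> 0) oW (fun a k => @Ck_cst _ _ _ k _
  0)). Qed.

Lemma connection_combinationl s Y a e : vector_field W Y -> W e -> dom a e ->
  nabla (combination s) Y a e = \sum_(i <- s) f i e *: nabla (F i) Y a e.
Proof.
move=> vY We ae; elim: s => [|i s IH].
  rewrite combination_nil big_nil zero_scale.
  have v0 := vector_field_0 hA oW.
  rewrite (scd_scalel hN oW smooth0 (im v0) (im vY) We ae).
  by rewrite /vf_scale scale0r.
rewrite combination_cons big_cons -IH.
have vs : vector_field W (vf_scale (fun=> f i) (F i)) 
  by apply: (vector_field_scale hA) => //; exact: scalar_field_fun.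
rewrite (scd_addl hN oW (im vs) (im (vector_field_combination s)) (im vY) We ae).
by rewrite /vf_add (scd_scalel hN oW (sf i) (im (vF i)) (im vY) We ae).
Qed.

Lemma connection_combinationr s X a e : vector_field W X -> W e -> dom a e ->
  nabla X (combination s) a e =
  \sum_(i <- s) (deriv_fun X (fun=> f i) a e *: F i a e + f i e *: nabla X (F i) a e).
Proof.
move=> vX We ae; elim: s => [|i s IH].
  rewrite combination_nil big_nil zero_scale.
  have v0 := vector_field_0 hA oW.
  rewrite (scd_leibniz hN oW smooth0 (im vX) (im v0) We ae).
  by rewrite /vf_add /vf_scale scaler0 scale0r addr0.
rewrite combination_cons big_cons -IH.
have vs : vector_field W (vf_scale (fun=> f i) (F i)) 
  by apply: (vector_field_scale hA) => //; exact: scalar_field_fun.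
rewrite (scd_addr hN oW (im vX) (im vs) (im (vector_field_combination s)) We ae).
by rewrite /vf_add (scd_leibniz hN oW (sf i) (im vX) (im (vF i)) We ae).
Qed.

End ConnectionCombinations.

(** * The frame and its coframe at a point, and the connection expanded in them *)

Section Frame.
Variables (R : realType) (n : nat) (A : set (ecoord R n)) (g : ecoord R n -> ecoord R n).
Hypothesis sg : semispray A g.
Local Notation V := (ecoord R n).
Local Notation rV := 'rV[R]_n.

Definition frame_list : seq (frame_index n) :=
  IG n :: map (@IV n) (index_enum 'I_n) ++ map (@IH n) (index_enum 'I_n).

Definition frame_value (p : frame_index n) (z : V) : V :=
  match p with
  | IG => g z
  | IV i => vert (unit_vec R i)
  | IH i => hor g z (unit_vec R i)
  end.

Definition coframe (p : frame_index n) (z v : V) : R :=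
  match p with
  | IG => v.1.1
  | IV i => psi g z v 0 i
  | IH i => theta z v 0 i
  end.

Lemma big_frame_list (U : zmodType) (f : frame_index n -> U) :
  \sum_(p <- frame_list) f p = f (IG n) + \sum_i f (IV i) + \sum_i f (IH i).
Proof. by rewrite /frame_list big_cons big_cat !big_map addrA. Qed.

Lemma frame_expansion z v : A z ->
  v = \sum_(p <- frame_list) coframe p z v *: frame_value p z.
Proof.
move=> Az; rewrite big_frame_list /=.
rewrite (sum_unit_vec _ (@vert_linear R n)) (sum_unit_vec _ (hor_linear g z)).
exact: (semispray_decomp sg).
Qed.

Lemma Ck_frame_value k p : Ck k A (frame_value p).
Proof.
case: p => [|i|i] /=; first exact: (semispray_smooth sg).
  exact: Ck_cst.
by apply: (Ck_hor sg); exact: Ck_cst.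
Qed.

Lemma Ck_coframe k p (x : V -> V) : Ck k A x -> Ck (W := R^o) k A (fun z => coframe p z (x z)).
Proof.
have oA := semispray_open sg => cx; case: p => [|i|i] /=.
- by apply: (Ck_fst oA); exact: Ck_fst.
- by apply: Ck_entry => //; exact: (Ck_psi sg).
by apply: Ck_entry => //; exact: (Ck_theta sg).
Qed.

Lemma dnonlin_linearr z w : A z -> linear (dnonlin g z w).
Proof.
move=> Az c h h'; rewrite /dnonlin.
have d : differentiable ('D_(vert w) g) z.
  exact: Ck_differentiable (Ck_derive _ (semispray_smooth sg 2%N)) Az.
by rewrite !deriveE // linearP /= scalerDr !scalerA [_ * c]mulrC.
Qed.

(** [w] is the direction of the inner derivative; exchanging the two derivatives moves it outside,
    where linearity is that of a differential. *)
Lemma dnonlin_linearl z h : A z -> linear (fun w => dnonlin g z w h).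
Proof.
move=> Az c w w'; rewrite /dnonlin.
have d : differentiable ('D_h g) z.
  exact: Ck_differentiable (Ck_derive _ (semispray_smooth sg 2%N)) Az.
have sym u : 'D_h ('D_(vert u) g) z = 'd ('D_h g) z (vert u).
  rewrite (symmetric_derivatives _ _ (has_coords_ecoord R n) (semispray_open sg) Az) ?deriveE //.
  exact: (semispray_smooth sg 2%N).
apply: etrans (congr1 (fun u : V => - 2^-1 *: u.2) (sym _)) _; apply: esym.
apply: etrans (congr2 (fun u v : V => c *: (- 2^-1 *: u.2) + - 2^-1 *: v.2) (sym w) (sym w')) _.
by rewrite vert_linear linearP /= scalerDr !scalerA [_ * c]mulrC.
Qed.

Definition connection_frame (z : V) (p q : frame_index n) : V :=
  match p, q with
  | IG, IH i => hor g z (nonlin g z (unit_vec R i))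
  | IG, IV i => vert (nonlin g z (unit_vec R i))
  | IH i, IH j => hor g z (dnonlin g z (unit_vec R i) (vert (unit_vec R j)))
  | IH i, IV j => vert (dnonlin g z (unit_vec R i) (vert (unit_vec R j)))
  | _, _ => 0
  end.

(** The left side is $\hat\nabla_XY$ expanded by the Leibniz rule in [y] and linearity in [x].
    Linearity of [vert], [hor], [nonlin] and [dnonlin] collapses the sums over frame indices. *)
Lemma connection_value_frame (z : V) (x y : V -> V) : A z -> differentiable y z ->
  \sum_(q <- frame_list)
    ('d ((fun z => coframe q z (y z)) : V -> R^o) z (x z) *: frame_value q z +
     coframe q z (y z) *: \sum_(p <- frame_list) coframe p z (x z) *: connection_frame z p q) =
  connection_value g z x y.
Proof.
move=> Az dy.
have lcomp (U U' U'' : lmodType R) (L : U -> U') (L' : U' -> U'') : linear L -> linear L' ->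
    linear (fun u => L' (L u)) by move=> l l' c u v; rewrite l l'.
have [dth _] := has_diff_theta (has_diff_diff 0 dy).
have [dps _] := has_diff_psi sg Az (has_diff_diff 0 dy) (has_diff_diff 0 dth).
rewrite big_split /= big_frame_list /=.
have -> : \sum_i 'd ((fun z => psi g z (y z) 0 i) : V -> R^o) z (x z) *: vert (unit_vec R i) =
    vert (diff_psi g z y (x z)).
  rewrite -(sum_unit_vec _ (@vert_linear R n)); apply: eq_bigr => i _.
  by have [_ ->] := has_diff_entry i (has_diff_diff (x z) dps).
have -> : \sum_i 'd ((fun z => theta z (y z) 0 i) : V -> R^o) z (x z) *: hor g z (unit_vec R i) =
    hor g z (diff_theta z y (x z)).
  rewrite -(sum_unit_vec _ (hor_linear g z)); apply: eq_bigr => i _.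
  by have [_ ->] := has_diff_entry i (has_diff_diff (x z) dth).
rewrite /connection_value -[RHS]addrA; congr (_ + _).
rewrite big_frame_list /=.
(* The connection has the same coefficients on the $V_i$ as on the $H_i$, so one computation with
   [L] equal to [vert] or [hor] covers both. *)
have inner (L : rV -> V) (w : rV) : linear L ->
    \sum_i w 0 i *: (\sum_(p <- frame_list) coframe p z (x z) *:
      match p with
      | IG => L (nonlin g z (unit_vec R i))
      | IH j => L (dnonlin g z (unit_vec R j) (vert (unit_vec R i)))
      | IV j => 0 end) =
    (x z).1.1 *: L (nonlin g z w) + L (dnonlin g z (theta z (x z)) (vert w)).
  move=> lL.
  have E1 i : \sum_(p <- frame_list) coframe p z (x z) *:
      match p with
      | IG => L (nonlin g z (unit_vec R i))
      | IH j => L (dnonlin g z (unit_vec R j) (vert (unit_vec R i)))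
      | IV j => 0 end =
      (x z).1.1 *: L (nonlin g z (unit_vec R i)) +
      L (dnonlin g z (theta z (x z)) (vert (unit_vec R i))).
    rewrite big_frame_list /= [X in _ + X + _]big1 ?addr0; last by move=> j _; rewrite scaler0.
    congr (_ + _).
    exact: (sum_unit_vec (theta z (x z)) (lcomp _ _ _ _ _ (dnonlin_linearl (vert (unit_vec R i))
      Az) lL)).
  rewrite (eq_bigr _ (fun i _ => congr1 (fun u => w 0 i *: u) (E1 i))).
  have l1 := lcomp _ _ _ _ _ (nonlin_linear g z) lL.
  have l2 := lcomp _ _ _ _ _ (@vert_linear R n) (lcomp _ _ _ _ _ (dnonlin_linearr (theta z (x
    z)) Az) lL).
  apply: etrans (congr2 (fun u v => (x z).1.1 *: u + v) (sum_unit_vec w l1) (sum_unit_vec w l2)).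
  rewrite scaler_sumr -big_split /=.
  by apply: eq_bigr => i _; rewrite scalerDr !scalerA mulrC.
(* The summand for [IG] vanishes: $\Gamma$ is parallel along every frame field. *)
rewrite [X in _ *: X](_ : _ = 0) ?scaler0 ?add0r; last first.
  by rewrite big_frame_list /= scaler0 !big1 ?addr0 // => i _; rewrite scaler0.
have Ev := inner _ (psi g z (y z)) (@vert_linear R n).
have Eh := inner _ (theta z (y z)) (hor_linear g z).
apply: etrans (congr2 +%R Ev Eh) _.
by rewrite scalerDr addrACA.
Qed.

End Frame.

(** * Comparison of the two sides of the formula on a chart domain *)

Section MassaPagani.
Variables (R : realType) (n : nat) (M : smooth_manifold R n).
Local Notation E := (evolution_space M).
Local Notation V := (ecoord R n).
Local Notation C := (idx (adapted M)).
Local Notation hE := (adapted_atlas M).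
Variable G : vfield (adapted M).
Hypothesis hG : second_order_field G.
Implicit Types (a b : C) (e : E) (W : set E) (X Y : vfield (adapted M)).

Let oT := chart_openT hE.

Lemma frame_valueE a p e : dom a e -> frame G a p e = frame_value (gloc G a) p (coord a e).
Proof.
by move=> ae; case: p => [|i|i] //=; [rewrite gloc_coord|rewrite frame_HE].
Qed.

Lemma partial_conn_coef a i j k e : dom a e ->
  partial_u a j (conn_coef G a k i) e =
  dnonlin (gloc G a) (coord a e) (unit_vec R i) (vert (unit_vec R j)) 0 k.
Proof.
move=> ae; have sg := semispray_gloc hG a oT.
have Az : (coord a @` (setT `&` dom a)) (coord a e) by exists e.
have hd := has_diff_entry k (has_diff_nonlin sg Az
  (has_diff_cst (unit_vec R i) (coord a e) (vert (unit_vec R j)))).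
have [|d E1] := has_diff_near (g := local_rep (Z := R^o) a (conn_coef G a k i)) _ hd.
  apply: (near_img oT I ae) => e' _ ae'.
  by rewrite (local_rep_coord hE) // conn_coefE.
by rewrite /partial_u deriveE // E1 nonlin0 add0r.
Qed.

Lemma massa_pagani_frameE a p q e : dom a e ->
  massa_pagani_frame G a p q e = connection_frame (gloc G a) (coord a e) p q.
Proof.
move=> ae; case: p q => [|i|i] [|j|j] //=.
- rewrite -(sum_unit_vec _ (@vert_linear R n)); apply: eq_bigr => k _.
  by rewrite conn_coefE.
- rewrite -(sum_unit_vec _ (hor_linear _ _)); apply: eq_bigr => k _.
  by rewrite conn_coefE // frame_HE.
- rewrite -(sum_unit_vec _ (@vert_linear R n)); apply: eq_bigr => k _.
  by rewrite partial_conn_coef.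
rewrite -(sum_unit_vec _ (hor_linear _ _)); apply: eq_bigr => k _.
by rewrite partial_conn_coef // frame_HE.
Qed.

Lemma massa_pagani_value nabla X Y a e : massa_pagani G nabla ->
  vector_field setT X -> vector_field setT Y -> dom a e ->
  nabla X Y a e = connection_value (gloc G a) (coord a e)
    (local_rep a (X a)) (local_rep a (Y a)).
Proof.
move=> [hN hF] vX vY ae; pose W := @dom _ _ _ (adapted M) a.
have oW : chart_open (adapted M) W by exact: (atlas_open hE).
have sW : W `<=` setT by [].
(* The frame lives over the domain of [a] only, so from here on all fields are regarded as sections
   over [W]. *)
have {}vX := vector_field_subset sW vX; have {}vY := vector_field_subset sW vY.
have sg := semispray_gloc hG a oW.
pose F p := field_of_chart a (frame_value (gloc G a) p) : vfield (adapted M).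
pose f (Z : vfield (adapted M)) p (e : E) : R :=
  coframe (gloc G a) p (coord a e) (local_rep a (Z a) (coord a e)).
have vF p : vector_field W (F p).
  by apply: (vector_field_of_chart hE) => // k; exact: (Ck_frame_value sg).
have FE p e' : W e' -> F p a e' = frame G a p e'.
  by move=> ae'; rewrite frame_valueE //; exact: (field_of_chartE hE).
have sf Z p : vector_field W Z -> smooth_fun_on (adapted M) W (f Z p).
  move=> vZ; apply: (smooth_fun_of_chart hE (f := fun z => coframe (gloc G a) p z (local_rep a
    (Z a) z))) => //.
  by move=> k; apply: (Ck_coframe sg); exact: vZ.2.
have expand Z : vector_field W Z -> vf_eq W Z (combination (f Z) F (frame_list n)).
  move=> vZ b e' We' be'.
  have Az : (coord a @` (W `&` dom a)) (coord a e') by exists e'.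
  (* Equality of fields is required in every chart [b]; the expansion is made in chart [a] and
     carried over by the linear Jacobian. *)
  rewrite (vZ.1 e' We' a b We' be') -[LHS]/(jac a b e' _).
  have -> : Z a e' = local_rep a (Z a) (coord a e') by rewrite (local_rep_coord hE).
  by rewrite {1}(frame_expansion sg (local_rep a (Z a) (coord a e')) Az) linear_sum; apply:
    eq_bigr => p _; rewrite linearZ.
have vC Z : vector_field W Z -> vector_field W (combination (f Z) F (frame_list n)).
  by move=> vZ; apply: (vector_field_combination hE) => // p; exact: sf.
have im (Z : vfield (adapted M)) : vector_field W Z -> im_on id W Z by [].
have rfl (Z : vfield (adapted M)) : vf_eq W Z Z by [].
rewrite (scd_local hN oW (im _ vX) (im _ vX) (im _ vY) (im _ (vC _ vY)) (rfl X) (expand _ vY) ae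
  ae).
rewrite (connection_combinationr hE hN oW (fun p => sf _ p vY) vF _ vX ae ae).
have Az : (coord a @` (W `&` dom a)) (coord a e) by exists e.
have dY := smooth_on_differentiable vY.2 (ae : W e) ae.
rewrite -(connection_value_frame sg _ Az dY); apply: eq_bigr => q _; congr (_ *: _ + _ *: _).
- rewrite /deriv_fun /along -(local_rep_coord hE (X a) ae).
  have dq : differentiable ((fun z => coframe (gloc G a) q z (local_rep a (Y a) z)) : V -> R^o)
    (coord a e).
    apply: Ck_differentiable Az; apply: (Ck_coframe (k := 1%N) sg); exact: vY.2.
  have [|_ ->] // := near_eq_differentiable (g := local_rep (Z := R^o) a (f Y q)) _ dq.
  by apply: (near_img oW (ae : W e) ae) => e' _ ae'; rewrite [RHS](local_rep_coord hE).
- exact: (field_of_chartE hE).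
(* With [Y] already expanded, [X] is replaced by its combination inside each derivative of a frame
   field [F q]. *)
rewrite (scd_local hN oW (im _ vX) (im _ (vC _ vX)) (im _ (vF q)) (im _ (vF q)) (expand _ vX)
  (rfl _) ae ae).
rewrite (connection_combinationl hE hN oW (fun p => sf _ p vX) vF _ (vF q) ae ae).
apply: eq_bigr => p _; congr (_ *: _).
rewrite -massa_pagani_frameE //.
by apply: (hF a p q W) => //; exact: FE.
Qed.

Lemma explicit_formula X Y a e : vector_field setT X -> vector_field setT Y -> dom a e ->
  connection_value (gloc G a) (coord a e) (local_rep a (X a)) (local_rep a (Y a)) =
  deriv_fun X (dt_of Y) a e *: G a e +
  tensor_Q G (bracket (proj_H G X) (tensor_S Y)) a e +
  tensor_S (bracket (proj_V G X) (tensor_Q G Y)) a e +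
  proj_H G (bracket (vf_sub X (proj_H G X)) (proj_H G Y)) a e +
  proj_V G (bracket (vf_sub X (proj_V G X)) (proj_V G Y)) a e.
Proof.
move=> vX vY ae; have sg := semispray_gloc hG a oT.
have Az : (coord a @` (setT `&` dom a)) (coord a e) by exists e.
have dX := smooth_on_differentiable vX.2 I ae.
have dY := smooth_on_differentiable vY.2 I ae.
rewrite -(connection_valueE sg Az dX dY).
have sm L (P : vfield (adapted M) -> vfield (adapted M)) Z : tensor_field L ->
    (forall Z a e, dom a e -> P Z a e = L a e (Z a e)) ->
    vector_field setT Z -> vector_field setT (P Z).
  move=> tL PE vZ; apply: (vector_field_eq hE oT) (vector_field_tensor tL oT vZ).
  by move=> b e' _ be'; rewrite PE.
have sub Z Z' := @vector_field_sub _ _ _ _ hE setT Z Z' oT.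
have vPH Z := sm _ _ Z (tensor_H_at hG) (proj_HE hG).
have vPV Z := sm _ _ Z (tensor_V_at hG) (proj_VE hG).
have vTQ Z := sm _ _ Z (tensor_Q_at hG) (tensor_QE hG).
have tensor_SE' Z (b : C) e' : tensor_S Z b e' = S_at b e' (Z b e') by rewrite tensor_SE.
have vTS Z := sm _ _ Z (tensor_S_at hG) (fun Z b e' _ => tensor_SE' Z b e').
have bl Z Z' z z' := @bracket_lie _ _ _ _ hE setT Z Z' z z' a e oT I ae.
have lc (Z : vfield (adapted M)) e' : dom a e' -> local_rep a (Z a) (coord a e') = Z a e'.
  exact: (local_rep_coord hE).
refine (congr2 +%R (congr2 +%R (congr2 +%R (congr2 +%R (congr2 *:%R _ _) _) _) _) _).
- have dt : differentiable ((fun z => (local_rep a (Y a) z).1.1) : V -> R^o) (coord a e).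
    exact: (has_diff_fst (has_diff_fst (has_diff_diff 0 dY))).1.
  have near_dt : \forall z \near coord a e, ((fun z => (local_rep a (Y a) z).1.1) : V -> R^o) z =
      local_rep (Z := R^o) a (dt_of Y a) z.
    by apply: (near_img oT I ae) => e' _ ae'; rewrite [RHS](local_rep_coord hE) // lc.
  have [_ E1] := near_eq_differentiable near_dt dt.
  by rewrite /deriv_fun /along E1 /diff_time lc.
- exact: gloc_coord.
- have B : bracket (proj_H G X) (tensor_S Y) a e =
      lie (fun q => local_H (gloc G a) q (local_rep a (X a) q)) (fun q => local_S q (local_rep a
        (Y a) q)) (coord a e).
    apply: bl; [exact: (vPH _ vX).2|exact: (vTS _ vY).2| |] => e' _ ae'.
      by rewrite proj_HE // lc.
    by rewrite tensor_SE lc.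
  exact: etrans (congr1 (local_Q (gloc G a) (coord a e)) (esym B)) (esym (tensor_QE hG _ ae)).
- have B : bracket (proj_V G X) (tensor_Q G Y) a e =
      lie (fun q => local_V (gloc G a) q (local_rep a (X a) q)) (fun q => local_Q (gloc G a) q
        (local_rep a (Y a) q)) (coord a e).
    apply: bl; [exact: (vPV _ vX).2|exact: (vTQ _ vY).2| |] => e' _ ae'.
      by rewrite proj_VE // lc.
    by rewrite tensor_QE // lc.
  exact: etrans (congr1 (local_S (coord a e)) (esym B)) (esym (tensor_SE' _ _ _)).
- have B : bracket (vf_sub X (proj_H G X)) (proj_H G Y) a e =
      lie (fun q => local_rep a (X a) q - local_H (gloc G a) q (local_rep a (X a) q)) (fun q =>
        local_H (gloc G a) q (local_rep a (Y a) q)) (coord a e).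
    apply: bl; [exact: (sub _ _ vX (vPH _ vX)).2|exact: (vPH _ vY).2| |] => e' _ ae'.
      by rewrite /vf_sub proj_HE // lc.
    by rewrite proj_HE // lc.
  exact: etrans (congr1 (local_H (gloc G a) (coord a e)) (esym B)) (esym (proj_HE hG _ ae)).
- have B : bracket (vf_sub X (proj_V G X)) (proj_V G Y) a e =
      lie (fun q => local_rep a (X a) q - local_V (gloc G a) q (local_rep a (X a) q)) (fun q =>
        local_V (gloc G a) q (local_rep a (Y a) q)) (coord a e).
    apply: bl; [exact: (sub _ _ vX (vPV _ vX)).2|exact: (vPV _ vY).2| |] => e' _ ae'.
      by rewrite /vf_sub proj_VE // lc.
    by rewrite proj_VE // lc.
  exact: etrans (congr1 (local_V (gloc G a) (coord a e)) (esym B)) (esym (proj_VE hG _ ae)).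
Qed.

(** Only the time component of the bracket survives $P_\Gamma$; it differentiates $dt(Y)$ along $X -
    P_\Gamma(X)$, while the submodule derivative supplies the part along $P_\Gamma(X)$. *)
Lemma extension_G X Y a e : vector_field setT X -> vector_field setT Y -> dom a e ->
  extension (proj_G G) (nabla_G G) X (proj_G G Y) a e = deriv_fun X (dt_of Y) a e *: G a e.
Proof.
move=> vX vY ae; have sg := semispray_gloc hG a oT.
have Az : (coord a @` (setT `&` dom a)) (coord a e) by exists e.
have dX := smooth_on_differentiable vX.2 I ae.
have dY := smooth_on_differentiable vY.2 I ae.
have vPG Z : vector_field setT Z -> vector_field setT (proj_G G Z).
  move=> vZ; apply: (vector_field_eq hE oT) (vector_field_tensor (tensor_G_at hG) oT vZ).
  by move=> b e' _ be'; rewrite proj_GE.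
have lc (Z : vfield (adapted M)) e' : dom a e' -> local_rep a (Z a) (coord a e') = Z a e'.
  exact: (local_rep_coord hE).
have PG1 Z e' : dom a e' -> (proj_G G Z a e').1.1 = (Z a e').1.1.
  by move=> ae'; rewrite /proj_G /= (hG.2 a e' ae') /= [_ *: 1]mulr1.
have B : bracket (vf_sub X (proj_G G X)) (proj_G G Y) a e =
    lie (fun q => local_rep a (X a) q - local_G (gloc G a) q (local_rep a (X a) q))
      (fun q => local_G (gloc G a) q (local_rep a (Y a) q)) (coord a e).
  apply: (bracket_lie hE oT I ae).
  - exact: (vector_field_sub hE oT vX (vPG _ vX)).2.
  - exact: (vPG _ vY).2.
  - by move=> e' _ ae'; rewrite /vf_sub proj_GE // lc.
  - by move=> e' _ ae'; rewrite proj_GE // lc.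
have D Z : deriv_fun Z (dt_of (proj_G G Y)) a e = deriv_fun Z (dt_of Y) a e.
  apply: (@along_eq _ _ _ _ hE R^o setT) => // [e' _ ae'|]; first exact: PG1.
  by case: (scalar_field_dt oT (vPG _ vY)).
have DY h : diff_time (coord a e) (local_rep a (Y a)) h =
    'd (local_rep (Z := R^o) a (dt_of Y a)) (coord a e) h.
  have dt : differentiable ((fun z => (local_rep a (Y a) z).1.1) : V -> R^o) (coord a e).
    exact: (has_diff_fst (has_diff_fst (has_diff_diff 0 dY))).1.
  have near_dt : \forall z \near coord a e, ((fun z => (local_rep a (Y a) z).1.1) : V -> R^o) z =
      local_rep (Z := R^o) a (dt_of Y a) z.
    by apply: (near_img oT I ae) => e' _ ae'; rewrite [RHS](local_rep_coord hE) // lc.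
  have [_ E1] := near_eq_differentiable near_dt dt.
  by rewrite E1.
rewrite /extension /vf_add {1}/nabla_G /vf_scale D.
have -> : proj_G G (bracket (vf_sub X (proj_G G X)) (proj_G G Y)) a e =
    deriv_fun (vf_sub X (proj_G G X)) (dt_of Y) a e *: G a e.
  rewrite {1}/proj_G /form_dt B (time_lie_sub_local_G sg Az dX dY) DY.
  by rewrite /deriv_fun /along /vf_sub proj_GE // lc.
by rewrite -scalerDl /deriv_fun /along -linearD /vf_sub addrC subrK.
Qed.

(** The inner projection disappears because $S P_H = S$. *)
Lemma extension_H X Y a e : vector_field setT X -> vector_field setT Y -> dom a e ->
  extension (proj_H G) (nabla_H G) X (proj_H G Y) a e =
  tensor_Q G (bracket (proj_H G X) (tensor_S Y)) a e +
  proj_H G (bracket (vf_sub X (proj_H G X)) (proj_H G Y)) a e.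
Proof.
move=> vX vY ae.
have sPH : smooth_on setT (proj_H G X).
  apply: (smooth_on_eq hE oT) (tensor_smooth (tensor_H_at hG) oT vX.2) => b e' _ be'.
  by rewrite (proj_HE hG).
have B : bracket (proj_H G X) (tensor_S (proj_H G Y)) a e = bracket (proj_H G X) (tensor_S Y) a e.
  apply/esym; apply: (bracket_eq hE oT) => // [|b e' _ be'].
    by rewrite tensor_SE; exact: (tensor_smooth (tensor_S_at hG) oT vY.2).
  by rewrite !tensor_SE /apply_tensor (proj_HE hG) // /S_at /local_S /H_at theta_hor.
apply: (congr1 (fun u => u + proj_H G (bracket (vf_sub X (proj_H G X)) (proj_H G Y)) a e)).
apply: etrans (tensor_QE hG _ ae) (etrans _ (esym (tensor_QE hG _ ae))).
exact: (congr1 (Q_at G a e) B).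
Qed.

(** The inner projection disappears because $Q P_V = Q$. *)
Lemma extension_V X Y a e : vector_field setT X -> vector_field setT Y -> dom a e ->
  extension (proj_V G) (nabla_V G) X (proj_V G Y) a e =
  tensor_S (bracket (proj_V G X) (tensor_Q G Y)) a e +
  proj_V G (bracket (vf_sub X (proj_V G X)) (proj_V G Y)) a e.
Proof.
move=> vX vY ae.
have sPV : smooth_on setT (proj_V G X).
  apply: (smooth_on_eq hE oT) (tensor_smooth (tensor_V_at hG) oT vX.2) => b e' _ be'.
  by rewrite (proj_VE hG).
have sQ : smooth_on setT (tensor_Q G Y).
  apply: (smooth_on_eq hE oT) (tensor_smooth (tensor_Q_at hG) oT vY.2) => b e' _ be'.
  by rewrite (tensor_QE hG).
have B : bracket (proj_V G X) (tensor_Q G (proj_V G Y)) a e = bracket (proj_V G X) (tensor_Q G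
  Y) a e.
  apply/esym; apply: (bracket_eq hE oT) => // b e' _ be'.
  by rewrite !(tensor_QE hG) // (proj_VE hG) // /Q_at /local_Q /V_at psi_vert.
apply: (congr1 (fun u => u + proj_V G (bracket (vf_sub X (proj_V G X)) (proj_V G Y)) a e)).
by rewrite /nabla_V !tensor_SE; exact: (congr1 (S_at a e) B).
Qed.

End MassaPagani.

Theorem theorem3p2 (R : realType) (n : nat) (M : smooth_manifold R n)
    (G : vfield (adapted M)) (hG : second_order_field G) :
  submodule_covariant_derivative (proj_G G) (nabla_G G) /\
  submodule_covariant_derivative (proj_H G) (nabla_H G) /\
  submodule_covariant_derivative (proj_V G) (nabla_V G) /\
  forall nabla : vfield (adapted M) -> vfield (adapted M) -> vfield (adapted M),
    massa_pagani G nabla ->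
    forall X Y : vfield (adapted M),
      vector_field setT X -> vector_field setT Y ->
      vf_eq setT (nabla X Y)
        (vf_add (vf_add (extension (proj_G G) (nabla_G G) X (proj_G G Y))
                        (extension (proj_H G) (nabla_H G) X (proj_H G Y)))
                (extension (proj_V G) (nabla_V G) X (proj_V G Y))) /\
      vf_eq setT (nabla X Y)
        (vf_add (vf_add (vf_add (vf_add
          (vf_scale (deriv_fun X (dt_of Y)) G)
          (tensor_Q G (bracket (proj_H G X) (tensor_S Y))))
          (tensor_S (bracket (proj_V G X) (tensor_Q G Y))))
          (proj_H G (bracket (vf_sub X (proj_H G X)) (proj_H G Y))))
          (proj_V G (bracket (vf_sub X (proj_V G X)) (proj_V G Y)))).
Proof.
split; first exact: nabla_G_scd.
split; first exact: nabla_H_scd.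
split; first exact: nabla_V_scd.
move=> nabla hN X Y vX vY.
have E a e : dom a e -> nabla X Y a e = _ := fun ae =>
  etrans (massa_pagani_value hG hN vX vY ae) (explicit_formula hG vX vY ae).
split=> a e _ ae; rewrite E //.
rewrite /vf_add extension_G // extension_H // extension_V //.
(* The extensions group the summands by projector, whereas the explicit formula lists the $Q$ and
   $S$ terms first; one transposition reconciles them. *)
rewrite -!addrA; congr (_ + (_ + _)); rewrite addrCA //.
Qed.
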